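(* Let $(U,\mathrm{dist})$ be a metric space of doubling dimension $D$, let $S\subseteq U$ be a set of $n$ points with aspect ratio $\Delta$, let $k,z$ be positive integers with $k+z<n$, and let $\epsilon>0$. There is an algorithm that, given an augmented cover tree $T$ for $S$ (in explicit representation), $k$, $z$ and $\epsilon$, returns a set $C\subseteq S$ with $|C|\le k$ and $r_C(S\setminus Z_C)\le(3+O(\epsilon))\,r^*_{k,z}(S)$, in time $O\big((k+z)^2(64/\epsilon)^{2D}(1/\epsilon)\log\Delta\big)$.
   Context: The doubling dimension of $(U,\mathrm{dist})$ is the minimum $D\ge0$ such that every ball $B(p,r)=\{q\in U:\mathrm{dist}(p,q)\le r\}$ is contained in the union of at most $2^D$ balls of radius $r/2$ centered at points of $U$. The aspect ratio of $S$ is $\Delta=d_{\max}/d_{\min}$, the ratio of the maximum and minimum distances between two distinct points of $S$. For $C\subseteq S$ and $X\subseteq S$, $r_C(X)=\max_{p\in X}\min_{q\in C}\mathrm{dist}(p,q)$. In the $k$-center problem with $z$ outliers, for $C\subseteq S$ let $Z_C$ be a set of $z$ points of $S$ with the largest distances from $C$; one seeks $C\subseteq S$ of size at most $k$ minimizing $r_C(S\setminus Z_C)$, and $r^*_{k,z}(S)$ denotes the optimal value. A cover tree $T$ for $S$ is a rooted tree with levels indexed by integers decreasing from the root; $T_\ell$ is the set of nodes at level $\ell$, each node $u$ is associated with a point $u.\mathrm{point}\in S$, the points of the nodes of $T_\ell$ are distinct, and every non-root node of $T_\ell$ has a parent in $T_{\ell+1}$. Writing $\mathrm{dist}(u,v)=\mathrm{dist}(u.\mathrm{point},v.\mathrm{point})$,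 for every level $\ell$: (1) the points of $T_\ell$ are contained in the points of $T_{\ell-1}$; (2) $\mathrm{dist}(u,u.\mathrm{parent})\le 2^{\ell+1}$ for $u\in T_\ell$; (3) $\mathrm{dist}(u,v)>2^\ell$ for distinct $u,v\in T_\ell$. In the explicit representation, maximal chains of same-point nodes each having only the same-point child are coalesced into a single node. An augmented cover tree additionally stores at each node $u$ the number $u.\mathrm{weight}$ of points of $S$ associated with nodes in the subtree rooted at $u$.
   Formalization: In the time bound, ε is replaced by min(ε,1) and log Δ by max(1, ln Δ), since the literal bound is 0 for Δ=1 and tends to 0 as ε grows, which no algorithm can meet; for ε≤1 and Δ≥e it is the stated bound. *)

(* Defs.v *)
From HB Require Import structures.
From mathcomp Require Import all_boot all_order all_algebra.
From mathcomp Require Import finmap.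
From mathcomp Require Import all_classical all_reals all_analysis.

Set Implicit Arguments.
Unset Strict Implicit.
Unset Printing Implicit Defensive.

Import Order.TTheory GRing.Theory Num.Theory.

Local Open Scope classical_set_scope.
Local Open Scope ring_scope.

Section Metric.
Context {R : realType} {U : metricType R}.
Implicit Types (S C X : {fset U}) (p q : U).

(* The library's [ball] is open; the doubling dimension uses closed balls. *)
Definition cball p (r : R) : set U := [set q | mdist p q <= r].

Definition doubling (D : R) : Prop :=
  forall p (r : R), exists2 X : seq U,
    (size X)%:R <= 2 `^ D &
    cball p r `<=` [set q | exists2 x, x \in X & cball x (r / 2) q].

Definition dmax S : R :=
  \big[Num.max/0]_(p <- S) \big[Num.max/0]_(q <- S | p != q) mdist p q.

(* The initial value [dmax S] of the minimum never lies below a distance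
   between two points of S. *)
Definition dmin S : R :=
  \big[Num.min/dmax S]_(p <- S)
    \big[Num.min/dmax S]_(q <- S | p != q) mdist p q.

Definition aspect_ratio S : R := dmax S / dmin S.

(* Extended reals make an empty set of centers infinitely far from every
   point. *)
Definition dist_to C p : \bar R := \big[mine/+oo%E]_(q <- C) (mdist p q)%:E.

Definition radius C X : \bar R := \big[maxe/0%E]_(p <- X) dist_to C p.

(* Ties are broken by the enumeration of S; they do not affect
   [outlier_radius]. *)
Definition outliers S (z : nat) C : {fset U} :=
  seq_fset tt
    (take z (sort (fun p q => (dist_to C q <= dist_to C p)%E) (enum_fset S))).

Definition outlier_radius S (z : nat) C : \bar R :=
  radius C (S `\` outliers S z C)%fset.

Definition opt_radius S (k z : nat) : \bar R :=
  \big[mine/+oo%E]_(C <- fpowerset S | (#|` C| <= k)%N) outlier_radius S z C.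

End Metric.

Definition doubling_dimension (R : realType) (U : metricType R) (D : R) : Prop :=
  [/\ 0 <= D, doubling (U := U) D &
      forall D', 0 <= D' -> doubling (U := U) D' -> D <= D'].

(* Nodes at one level have distinct points, so the node of level l with point
   p is the pair (l, p).  The tree has no lowest level (nesting is required at
   every level); its bottom is a family of infinite chains of same-point nodes,
   each coalesced into one leaf of the explicit representation. *)
Record ctree (U : choiceType) := CTree {
  root_level : int;
  pts : int -> {fset U};     (* points of the nodes at a given level *)
  par : int -> U -> U        (* par l p: point of the parent of (l, p) *)
}.

Section CoverTree.
Context {R : realType} {U : metricType R}.
Implicit Types (S : {fset U}) (T : ctree U) (l m : int) (p q : U).

Record cover_tree S T : Prop := {
  ct_root : #|` pts T (root_level T)| = 1%N;
  ct_above : forall l, root_level T < l -> pts T l = fset0;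
  ct_sub : forall l, (pts T l `<=` S)%fset;
  ct_all : forall p, p \in S -> exists l, p \in pts T l;
  ct_parent : forall l p, l < root_level T -> p \in pts T l ->
    par T l p \in pts T (l + 1);
  ct_nesting : forall l, (pts T l `<=` pts T (l - 1))%fset;
  ct_covering : forall l p, l < root_level T -> p \in pts T l ->
    mdist p (par T l p) <= 2 ^ (l + 1);
  ct_separation : forall l p q, p \in pts T l -> q \in pts T l -> p != q ->
    2 ^ l < mdist p q
}.

Definition node T l p : Prop := p \in pts T l.

Definition child T l p q : Prop := node T (l - 1) q /\ par T (l - 1) q = p.

(* Point of the j-th ancestor of (l, p). *)
Fixpoint ancestor T l (j : nat) p : U :=
  if j is j'.+1 then ancestor T (l + 1) j' (par T l p) else p.

Definition in_subtree T l p (x : U) : Prop :=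
  exists j : nat, node T (l - j%:Z) x /\ ancestor T (l - j%:Z) j x = p.

Definition weight S T l p : nat := #|` [fset x in S | `[< in_subtree T l p x >]]%fset|.

Definition only_self_child T l p : Prop := forall q, child T l p q <-> q = p.

(* (l, p) and its parent lie in a common chain of same-point nodes each having
   only the same-point child. *)
Definition coalesced T l p : Prop :=
  [/\ l < root_level T, par T l p = p,
      only_self_child T (l + 1) p & only_self_child T l p].

(* A node of the explicit representation is named by the topmost node of the
   maximal chain that it stands for. *)
Definition explicit_node T l p : Prop := node T l p /\ ~ coalesced T l p.

Definition explicit_child T l p m q : Prop :=
  [/\ explicit_node T m q, m < l, par T m q = p &
      forall j, m + 1 <= j -> j < l -> coalesced T j p].

End CoverTree.

(* Programs for a random access machine.  The memory consists of arrays of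
   integers, of reals and of points, named by numerals fixed in the program and
   indexed by integers.  Integers can be added, subtracted and compared; reals
   support the field operations and comparison; points can only be copied and
   passed to the distance oracle.  Programs depend neither on the real field
   nor on the metric space. *)
Inductive iexp :=
  | IConst of int
  | IGet of nat & iexp
  | IAdd of iexp & iexp
  | ISub of iexp & iexp.

Inductive pexp := PGet of nat & iexp.

Inductive rexp :=
  | RInt of iexp
  | RGet of nat & iexp
  | RDist of pexp & pexp
  | RAdd of rexp & rexp
  | RSub of rexp & rexp
  | RMul of rexp & rexp
  | RDiv of rexp & rexp.

Inductive bexp :=
  | ILe of iexp & iexp
  | RLe of rexp & rexp
  | BNot of bexp
  | BAnd of bexp & bexp.

Inductive cmd :=
  | Skip
  | ISet of nat & iexp & iexp
  | RSet of nat & iexp & rexp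
  | PSet of nat & iexp & pexp
  | Seq of cmd & cmd
  | If of bexp & cmd & cmd
  | While of bexp & cmd.

Fixpoint icost (e : iexp) : nat :=
  match e with
  | IConst _ => 1
  | IGet _ e => (icost e).+1
  | IAdd e f | ISub e f => (icost e + icost f)%N.+1
  end.

Definition pcost (e : pexp) : nat := let: PGet _ e := e in (icost e).+1.

Fixpoint rcost (e : rexp) : nat :=
  match e with
  | RInt e => (icost e).+1
  | RGet _ e => (icost e).+1
  | RDist x y => (pcost x + pcost y)%N.+1
  | RAdd e f | RSub e f | RMul e f | RDiv e f => (rcost e + rcost f)%N.+1
  end.

Fixpoint bcost (b : bexp) : nat :=
  match b with
  | ILe e f => (icost e + icost f)%N.+1
  | RLe e f => (rcost e + rcost f)%N.+1
  | BNot b => (bcost b).+1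
  | BAnd b c => (bcost b + bcost c)%N.+1
  end.

Record memory (R : realType) (U : metricType R) := Memory {
  imem : nat -> int -> int;
  rmem : nat -> int -> R;
  pmem : nat -> int -> U
}.

Definition update (A : Type) (f : nat -> int -> A) (a : nat) (i : int) (v : A) :
    nat -> int -> A :=
  fun b j => if (b == a) && (j == i) then v else f b j.

Section Machine.
Context {R : realType} {U : metricType R}.
Implicit Types M : memory U.

Fixpoint ieval M (e : iexp) : int :=
  match e with
  | IConst c => c
  | IGet a e => imem M a (ieval M e)
  | IAdd e f => ieval M e + ieval M f
  | ISub e f => ieval M e - ieval M f
  end.

Definition peval M (e : pexp) : U := let: PGet a e := e in pmem M a (ieval M e).

Fixpoint reval M (e : rexp) : R :=
  match e with
  | RInt e => (ieval M e)%:~R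
  | RGet a e => rmem M a (ieval M e)
  | RDist x y => mdist (peval M x) (peval M y)
  | RAdd e f => reval M e + reval M f
  | RSub e f => reval M e - reval M f
  | RMul e f => reval M e * reval M f
  | RDiv e f => reval M e / reval M f
  end.

Fixpoint beval M (b : bexp) : bool :=
  match b with
  | ILe e f => ieval M e <= ieval M f
  | RLe e f => reval M e <= reval M f
  | BNot b => ~~ beval M b
  | BAnd b c => beval M b && beval M c
  end.

(* exec c M t M': started in memory M, c halts after t steps in memory M'. *)
Inductive exec : cmd -> memory U -> nat -> memory U -> Prop :=
  | exec_skip M : exec Skip M 1 M
  | exec_iset a i e M :
      exec (ISet a i e) M (icost i + icost e)%N.+1
        (Memory (update (imem M) a (ieval M i) (ieval M e)) (rmem M) (pmem M))
  | exec_rset a i e M :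
      exec (RSet a i e) M (icost i + rcost e)%N.+1
        (Memory (imem M) (update (rmem M) a (ieval M i) (reval M e)) (pmem M))
  | exec_pset a i e M :
      exec (PSet a i e) M (icost i + pcost e)%N.+1
        (Memory (imem M) (rmem M) (update (pmem M) a (ieval M i) (peval M e)))
  | exec_seq c d M1 M2 M3 t u :
      exec c M1 t M2 -> exec d M2 u M3 -> exec (Seq c d) M1 (t + u)%N M3
  | exec_if b c d M M' t :
      exec (if beval M b then c else d) M t M' ->
      exec (If b c d) M (bcost b + t)%N.+1 M'
  | exec_while_false b c M :
      ~~ beval M b -> exec (While b c) M (bcost b).+1 M
  | exec_while_true b c M1 M2 M3 t u :
      beval M1 b -> exec c M1 t M2 -> exec (While b c) M2 u M3 ->
      exec (While b c) M1 (bcost b + t + u)%N.+1 M3.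

(* Layout of a stored tree: an explicit node is identified by a nonnegative
   integer a, and its record consists of the cells of index a of the integer
   arrays 0 (level), 1 (weight), 2 (parent), 3 (first child), 4 (next sibling)
   and of the point array 0 (point); -1 is the null pointer. *)
Fixpoint linked M (a : int) (s : seq int) : Prop :=
  if s is b :: s' then a = b /\ linked M (imem M 4 b) s' else a = -1.

Record stores_tree (S : {fset U}) (T : ctree U) (root : int) M
    (addr : int * U -> int) : Prop := {
  st_addr : forall l p, explicit_node T l p -> 0 <= addr (l, p);
  st_root : forall p, node T (root_level T) p ->
    root = addr (root_level T, p) /\ imem M 2 root = -1;
  st_level : forall l p, explicit_node T l p -> imem M 0 (addr (l, p)) = l;
  st_weight : forall l p, explicit_node T l p ->
    imem M 1 (addr (l, p)) = (weight S T l p)%:Z;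
  st_point : forall l p, explicit_node T l p -> pmem M 0 (addr (l, p)) = p;
  st_parent : forall l p m q, explicit_node T l p -> explicit_child T l p m q ->
    imem M 2 (addr (m, q)) = addr (l, p);
  st_children : forall l p, explicit_node T l p ->
    exists s : seq (int * U),
      [/\ uniq s,
          forall m q, (m, q) \in s <-> explicit_child T l p m q &
          linked M (imem M 3 (addr (l, p))) (map addr s)]
}.

(* The cells not mentioned here have arbitrary contents. *)
Definition input (S : {fset U}) (T : ctree U) (k z : nat) (eps : R) M : Prop :=
  [/\ exists addr, stores_tree S T (imem M 5 0) M addr,
      imem M 5 1 = k%:Z, imem M 5 2 = z%:Z & rmem M 0 0 = eps].

(* The output is the set of the first m entries of the point array 1, where m
   is left in cell 0 of the integer array 5. *)
Definition output M (C : {fset U}) : Prop :=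
  exists2 m : nat, imem M 5 0 = m%:Z &
    C = seq_fset tt [seq pmem M 1 i%:Z | i <- iota 0 m].

End Machine.

(* The bound (k+z)^2 (64/eps)^(2D) (1/eps) log Delta.  It tends to 0 as eps
   grows or as Delta approaches 1, where no running time can obey it; it is
   therefore read with eps capped at 1 and the logarithm at least 1.  Nothing
   changes when eps <= 1 and Delta >= e. *)
Definition time_bound (R : realType) (k z : nat) (eps D Delta : R) : R :=
  let eps1 := Num.min eps 1 in
  (k + z)%N%:R ^+ 2 * (64 / eps1) `^ (2 * D) * (1 / eps1) * Num.max 1 (ln Delta).

(* Main.v *)
(** Write K = k + z and e = min(eps, 1).  The program descends the tree to the
    level l with |T_(l+1)| <= K < |T_l| and then j levels further, where
    4 <= 2^j e < 8.  Two of any K + 1 points of T_l that an optimal solution does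
    not discard share a center, so the optimum r* exceeds 2^(l-1); hence the
    points of T_(l-j), weighted by their subtrees, are proxies at distance at most
    2^(l-j+1) <= e r*, and repeated halving of balls shows that there are at most
    K (64/e)^D of them.  For a guess r, a greedy choice of k balls of radius
    rho = (1+2e) r of maximal uncovered weight, each covering its concentric ball
    of radius 3 rho, leaves weight at most z as soon as r >= r*: each greedy ball
    either meets an optimal cluster, which it then covers, or outweighs one.  The
    guesses grow by the factor 1+e, starting from an eighth of a distance between
    two siblings at level at most l, so O((1/e) log Delta) of them suffice.  One
    guess takes quadratic time because the weight of a proxy is subtracted from
    the balls containing it only once. *)
Require Import Defs.
From HB Require Import structures.
From mathcomp Require Import all_boot all_order all_algebra.
From mathcomp Require Import finmap zify ring lra.
From mathcomp Require Import all_classical all_reals all_analysis.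

Import Order.TTheory GRing.Theory Num.Theory.

Local Open Scope ring_scope.

(** * Programs with a step budget *)

(** The explicit representation stores no level of the tree as such. Level L is recovered as a list
    of explicit nodes whose coalesced chains cross L. All explicit children of a node lie on one
    level, so looking at first children yields the next level where the list changes, and the levels
    between are skipped. A visited level m contains an explicit node, whose failure to be coalesced
    exhibits two points of [S] at distance between 2^(m-1) and 2^(m+1); this bounds the number of
    visited levels by the logarithm of 4 Delta, although level numbers themselves are unrelated to
    Delta. For the same reason 2^l is never computed, and the scale of the guesses is a distance d
    read off the tree: d is at most 4 * 2^l, which is below 8 times the optimum, while the optimum
    is at most [dmax S], hence at most Delta d. So the guesses have to bridge a factor of at most 8
    Delta.

    The level l is not known beforehand either: it is recognized as the first visited level at which
    the list has more than k + z nodes. *)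

Fixpoint imods (c : cmd) : seq nat :=
  match c with
  | ISet a _ _ => [:: a]
  | Seq c d | If _ c d => imods c ++ imods d
  | While _ c => imods c
  | _ => [::]
  end.

Fixpoint rmods (c : cmd) : seq nat :=
  match c with
  | RSet a _ _ => [:: a]
  | Seq c d | If _ c d => rmods c ++ rmods d
  | While _ c => rmods c
  | _ => [::]
  end.

Fixpoint pmods (c : cmd) : seq nat :=
  match c with
  | PSet a _ _ => [:: a]
  | Seq c d | If _ c d => pmods c ++ pmods d
  | While _ c => pmods c
  | _ => [::]
  end.

Section ProgramLogic.
Context {R : realType} {U : metricType R}.
Implicit Types (M : memory U) (n : nat) (c : cmd).

Definition put_int M a i v := Memory (update (imem M) a i v) (rmem M) (pmem M).
Definition put_real M a i v := Memory (imem M) (update (rmem M) a i v) (pmem M).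
Definition put_point M a i v := Memory (imem M) (rmem M) (update (pmem M) a i v).

Lemma update_other (A : Type) (f : nat -> int -> A) a i v b :
  b != a -> update f a i v b = f b.
Proof. by move=> ba; apply/funext => x; rewrite /update (negbTE ba). Qed.

Lemma update_same (A : Type) (f : nat -> int -> A) a i v :
  update f a i v a i = v.
Proof. by rewrite /update !eqxx. Qed.

Definition unchanged (mi rs ps : seq nat) M M' : Prop :=
  [/\ forall a, a \notin mi -> imem M' a = imem M a,
      forall a, a \notin rs -> rmem M' a = rmem M a &
      forall a, a \notin ps -> pmem M' a = pmem M a].

Definition frame c := unchanged (imods c) (rmods c) (pmods c).

Lemma unchanged_refl mi rs ps M : unchanged mi rs ps M M.
Proof. by []. Qed.

Lemma unchanged_trans {mi rs ps} M2 {M1 M3} :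
  unchanged mi rs ps M1 M2 -> unchanged mi rs ps M2 M3 ->
  unchanged mi rs ps M1 M3.
Proof.
move=> [i1 r1 p1] [i2 r2 p2]; split=> a Ha.
- by rewrite i2 // i1.
- by rewrite r2 // r1.
- by rewrite p2 // p1.
Qed.

Lemma unchangedW mi rs ps mi' rs' ps' M M' :
  {subset mi <= mi'} -> {subset rs <= rs'} -> {subset ps <= ps'} ->
  unchanged mi rs ps M M' -> unchanged mi' rs' ps' M M'.
Proof.
move=> si sr sp [ui ur up]; split=> a Ha.
- by apply: ui; apply: contra Ha => /si.
- by apply: ur; apply: contra Ha => /sr.
- by apply: up; apply: contra Ha => /sp.
Qed.

Lemma exec_frame c M t M' : exec c M t M' -> frame c M M'.
Proof.
rewrite /frame; elim=> {c M t M'} //=.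
- by move=> a i e M; split=> //= b; rewrite inE => ba; rewrite update_other.
- by move=> a i e M; split=> //= b; rewrite inE => ba; rewrite update_other.
- by move=> a i e M; split=> //= b; rewrite inE => ba; rewrite update_other.
- move=> c d M1 M2 M3 t u _ H1 _ H2; apply: (unchanged_trans M2).
    by apply: unchangedW H1 => x Hx; rewrite mem_cat Hx.
  by apply: unchangedW H2 => x Hx; rewrite mem_cat Hx orbT.
- move=> b c d M M' t _; apply: unchangedW => x Hx; rewrite mem_cat;
    by move: Hx; case: (beval M b) => ->; rewrite ?orbT.
- by move=> b c M1 M2 M3 t u _ _ H1 _ H2; apply: (unchanged_trans M2).
Qed.

(* Q is also given the steps left over, so that invariants carry the remaining
   budget; a loop halts because every iteration uses some of it. *)
Definition wp c n M (Q : nat -> memory U -> Prop) : Prop :=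
  exists t M', [/\ exec c M t M', (t <= n)%N & Q (n - t)%N M'].

Lemma wp_conseq c n M (Q Q' : nat -> memory U -> Prop) :
  wp c n M Q -> (forall n' M', frame c M M' -> Q n' M' -> Q' n' M') ->
  wp c n M Q'.
Proof.
move=> [t [M' [e tn q]]] QQ; exists t, M'; split=> //.
by apply: QQ => //; apply: exec_frame e.
Qed.

Lemma wp_skip n M Q : (1 <= n)%N -> Q (n - 1)%N M -> wp Skip n M Q.
Proof. by move=> n1 q; exists 1%N, M; split=> //; constructor. Qed.

Lemma wp_iset a i e n M (Q : nat -> memory U -> Prop) :
  (icost i + icost e < n)%N ->
  Q (n - (icost i + icost e).+1)%N (put_int M a (ieval M i) (ieval M e)) ->
  wp (ISet a i e) n M Q.
Proof. by move=> n1 q; do 2!eexists; split; [constructor| |exact: q]. Qed.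

Lemma wp_rset a i e n M (Q : nat -> memory U -> Prop) :
  (icost i + rcost e < n)%N ->
  Q (n - (icost i + rcost e).+1)%N (put_real M a (ieval M i) (reval M e)) ->
  wp (RSet a i e) n M Q.
Proof. by move=> n1 q; do 2!eexists; split; [constructor| |exact: q]. Qed.

Lemma wp_pset a i e n M (Q : nat -> memory U -> Prop) :
  (icost i + pcost e < n)%N ->
  Q (n - (icost i + pcost e).+1)%N (put_point M a (ieval M i) (peval M e)) ->
  wp (PSet a i e) n M Q.
Proof. by move=> n1 q; do 2!eexists; split; [constructor| |exact: q]. Qed.

Lemma wp_seq c d n M Q :
  wp c n M (fun n' M' => wp d n' M' Q) -> wp (Seq c d) n M Q.
Proof.
move=> [t [M1 [e1 tn [u [M2 [e2 un q]]]]]]; exists (t + u)%N, M2; split.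
- by apply: exec_seq e1 e2.
- by move: tn un; clear; lia.
- by rewrite subnDA.
Qed.

Lemma wp_if b c d n M Q :
  (bcost b < n)%N ->
  (beval M b -> wp c (n - (bcost b).+1) M Q) ->
  (~~ beval M b -> wp d (n - (bcost b).+1) M Q) ->
  wp (If b c d) n M Q.
Proof.
move=> bn Hc Hd.
have [t [M' [e tn q]]] :
    wp (if beval M b then c else d) (n - (bcost b).+1) M Q.
  by case: ifP => [/Hc|/negbT/Hd].
exists (bcost b + t).+1, M'; split; first exact: exec_if.
  by move: bn tn; clear; lia.
by rewrite -addSn subnDA.
Qed.

Lemma wp_while b c (I : nat -> memory U -> Prop) n M Q :
  I n M ->
  (forall n' M', frame c M M' -> I n' M' -> (bcost b < n')%N) ->
  (forall n' M', frame c M M' -> I n' M' -> beval M' b ->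
     wp c (n' - (bcost b).+1) M' I) ->
  (forall n' M', frame c M M' -> I n' M' -> ~~ beval M' b ->
     Q (n' - (bcost b).+1)%N M') ->
  wp (While b c) n M Q.
Proof.
move=> In Hn Hc Hq.
suff H M1 : frame c M M1 -> I n M1 -> wp (While b c) n M1 Q.
  by apply: H => //; apply: unchanged_refl.
elim/ltn_ind: n M1 {In} => n IH M1 fr In.
have bn := Hn _ _ fr In.
case: (boolP (beval M1 b)) => Hb; last first.
  by exists (bcost b).+1, M1; split=> //; [constructor|apply: Hq].
have [t [M2 [e2 tn I2]]] := Hc _ _ fr In Hb.
have fr2 := unchanged_trans M1 fr (exec_frame _ _ _ _ e2).
have [|u [M3 [e3 un q]]] := IH _ _ M2 fr2 I2.
  by move: bn tn; clear; lia.
exists (bcost b + t + u).+1, M3; split.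
- by apply: exec_while_true Hb e2 e3.
- by move: bn tn un; clear; lia.
- by move: q; congr (Q _ _); move: bn tn un; clear; lia.
Qed.

(** * Counting loops *)

Definition for_loop (v b : nat) (s : int) c : cmd :=
  Seq (ISet v (IConst 0) (IConst 0))
    (While (ILe (IAdd (IGet v (IConst 0)) (IConst 1)) (IGet b (IConst s)))
      (Seq c (ISet v (IConst 0) (IAdd (IGet v (IConst 0)) (IConst 1))))).

Definition loop_frame v c :=
  unchanged (imods c ++ [:: v]) (rmods c) (pmods c).

(** The invariant also receives the remaining budget, so that costs can be amortized over the
    iterations. The constants come from the cost model: 3 steps set the counter, 8 test it and 6
    increment it. *)
Lemma wp_for_budget v b s c (N : nat) (I : nat -> nat -> memory U -> Prop)
    n M Q :
  v \notin imods c -> b \notin imods c ++ [:: v] ->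
  imem M b s = N%:Z -> (3 <= n)%N ->
  I 0%N (n - 3)%N (put_int M v 0 0) ->
  (forall i n' M', I i n' M' -> 8 <= n')%N ->
  (forall i n' M', (i < N)%N -> loop_frame v c M M' ->
    imem M' v 0 = i%:Z -> I i n' M' ->
    wp c (n' - 8) M' (fun n2 M2 => (6 <= n2)%N /\
      I i.+1 (n2 - 6)%N (put_int M2 v 0 i.+1%:Z))) ->
  (forall n' M', loop_frame v c M M' ->
    imem M' v 0 = N%:Z -> I N n' M' -> Q (n' - 8)%N M') ->
  wp (for_loop v b s c) n M Q.
Proof.
move=> vc bv bN n3 I0 I8 Hc Hq.
have bv' : b != v by move: bv; rewrite mem_cat inE negb_or => /andP[].
apply: wp_seq; apply: wp_iset => //=.
set M0 := put_int M v 0 0.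
have fr0 : loop_frame v c M M0.
  split=> //= a; rewrite mem_cat inE negb_or => /andP[_ av].
  exact: update_other.
have frb M' : loop_frame v c M M' -> imem M' b s = N%:Z.
  by case=> fi _ _; rewrite fi.
pose J n' M' := loop_frame v c M M' /\
  exists2 i : nat, (i <= N)%N & imem M' v 0 = i%:Z /\ I i n' M'.
apply: (wp_while _ _ J).
- by split=> //; exists 0%N => //; rewrite /= update_same.
- by move=> n' M' _ [_ [i _ [_ /I8]]].
- move=> n' M' _ [fr [i iN [iv Ii]]] /=; rewrite iv frb // => lt.
  apply: wp_seq; apply: (wp_conseq _ _ _ _ _ (Hc i _ _ _ fr iv Ii)).
    by move: lt; clear; lia.
  move=> n2 M2 fr2 [n26 I2]; apply: wp_iset => //=.
  have -> : imem M2 v 0 = i%:Z by case: fr2 => -> //.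
  have -> : i%:Z + 1 = i.+1%:Z by clear; lia.
  split; last first.
    by exists i.+1; [move: lt; clear; lia|rewrite /= update_same].
  apply: unchanged_trans fr _; case: fr2 => f1 f2 f3; split=> //= a.
  rewrite mem_cat inE negb_or => /andP[ac av].
  by rewrite update_other // f1.
- move=> n' M' _ [fr [i iN [iv Ii]]] /=; rewrite iv frb // => lt.
  have E : i = N by move: lt iN; clear; lia.
  by rewrite E in iv Ii; apply: Hq.
Qed.

(** The case of a uniform cost [T]: test and increment add 14 steps to each iteration, and 11 more
    pay for the initialization and the failing test. *)
Lemma wp_for v b s c (N T : nat) (I : nat -> memory U -> Prop) n M Q :
  v \notin imods c -> b \notin imods c ++ [:: v] ->
  imem M b s = N%:Z -> (N * (T + 14) + 11 <= n)%N ->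
  I 0%N (put_int M v 0 0) ->
  (forall i n' M', (i < N)%N -> loop_frame v c M M' ->
    imem M' v 0 = i%:Z -> I i M' -> (T <= n')%N ->
    wp c n' M' (fun n2 M2 => (n' - T <= n2)%N /\
      I i.+1 (put_int M2 v 0 i.+1%:Z))) ->
  (forall n' M', loop_frame v c M M' -> (n - (N * (T + 14) + 11) <= n')%N ->
    imem M' v 0 = N%:Z -> I N M' -> Q n' M') ->
  wp (for_loop v b s c) n M Q.
Proof.
move=> vc bv bN nN I0 Hc Hq.
pose r := (n - (N * (T + 14) + 11))%N.
apply: (wp_for_budget _ _ _ _ N
  (fun i n' M' => ((N - i) * (T + 14) + 8 + r <= n')%N /\ I i M')) => //.
- by move: nN; clear; case: (_ * _)%N => [|x]; lia.
- by split=> //; rewrite /r subn0; move: nN; clear; move: (_ * _)%N => x; lia.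
- by move=> i n' M' [H _]; move: H; clear; move: (_ * _)%N => x; lia.
- move=> i n' M' iN fr iv [nn Ii].
  have E : (N - i = (N - i.+1).+1)%N by move: iN; clear; lia.
  rewrite E mulSn in nn.
  apply: wp_conseq (Hc i _ _ iN fr iv Ii _) _ => [|n2 M2 _ [n2T I2]].
    by move: nn; clear; move: (_ * _)%N => x; lia.
  by split; [|split=> //]; move: nn n2T; clear; move: (_ * _)%N => x; lia.
- move=> n' M' fr iv [nn IN]; apply: Hq => //.
  by rewrite -/r; move: nn; clear; rewrite subnn mul0n; lia.
Qed.

End ProgramLogic.

(** * Cover trees *)

Lemma int_ind_down (P : int -> Prop) (a : int) :
  P a -> (forall l, l < a -> P (l + 1) -> P l) -> forall l, l <= a -> P l.
Proof.
move=> Pa IH l la.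
have [n ->] : exists n : nat, l = a - n%:Z.
  by exists `|a - l|%N; move: la; clear; lia.
elim: n {la} => [|n Pn]; first by rewrite subr0.
apply: IH; first by clear; lia.
by have -> : a - n.+1%:Z + 1 = a - n%:Z by clear; lia.
Qed.

(** From any element of a block, [g] recovers the label [h v] of that block, so distinct labels keep
    the blocks disjoint. *)
Lemma uniq_flatten_map (V X : eqType) (Y : eqType) (f : V -> seq X)
    (g : X -> Y) (h : V -> Y) (s : seq V) :
  uniq (map h s) -> (forall v, v \in s -> uniq (f v)) ->
  (forall v x, v \in s -> x \in f v -> g x = h v) ->
  uniq (flatten (map f s)).
Proof.
elim: s => //= v s IH /andP[vs us] uf gh; rewrite cat_uniq uf ?mem_head //=.
rewrite IH //; first last.
- by move=> w x ws; apply: gh; rewrite inE ws orbT.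
- by move=> w ws; apply: uf; rewrite inE ws orbT.
rewrite andbT; apply/hasPn => x /flatten_mapP[w ws xw]; apply/negP => /= xv.
move/negP: vs; apply; apply/mapP; exists w => //.
by rewrite -(gh v x) ?mem_head // (gh w x) // inE ws orbT.
Qed.

Lemma bigmin_seq_le {d : Order.disp_t} {X : orderType d} {I : eqType} (x : X)
    (r : seq I) i0 (P : pred I) (F : I -> X) : i0 \in r -> P i0 ->
  (\big[Order.min/x]_(i <- r | P i) F i <= F i0)%O.
Proof.
elim: r => //= i r IH; rewrite inE big_cons => /predU1P[<- ->|ir Pi].
  by rewrite ge_min lexx.
by case: ifP => _; rewrite ?ge_min IH ?orbT.
Qed.

Lemma bigmin_seq_attained {d : Order.disp_t} {X : orderType d} {I : eqType}
    (x : X) (r : seq I) (P : pred I) (F : I -> X) :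
  (\big[Order.min/x]_(i <- r | P i) F i)%O = x \/
  exists i, [/\ i \in r, P i & (\big[Order.min/x]_(i <- r | P i) F i)%O = F i].
Proof.
elim: r => [|i r IH]; first by left; rewrite big_nil.
rewrite big_cons; set b := (\big[_/_]_(_ <- _ | _) _)%O in IH *.
have {}IH : b = x \/ exists j, [/\ j \in i :: r, P j & b = F j].
  case: IH => [|[j [jr Pj e]]]; [by left|right; exists j; split=> //].
  by rewrite inE jr orbT.
case: ifP => // Pi; rewrite minEle; case: ifP => // _.
by right; exists i; rewrite mem_head.
Qed.

(** * Largest and smallest distances *)

Section Distances.
Context {R : realType} {U : metricType R}.
Implicit Types S : {fset U}.

Lemma dmax_ge0 S : 0 <= dmax S.
Proof.
apply: (big_ind (fun x => 0 <= x)) => // [x y x0 _|p _]; first by rewrite le_max x0.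
apply: (big_ind (fun x => 0 <= x)) => // [x y x0 _|q _]; first by rewrite le_max x0.
exact: mdist_ge0.
Qed.

Lemma le_dmax S p q : p \in S -> q \in S -> mdist p q <= dmax S.
Proof.
move=> pS qS; have [->|pq] := eqVneq p q; first by rewrite mdistxx dmax_ge0.
apply: le_trans (le_bigmax_seq _ _ _ (fun p => \big[Num.max/0]_(q <- S | p != q)
  mdist p q) pS isT).
exact: (le_bigmax_seq _ _ _ (fun q => mdist p q) qS pq).
Qed.

Lemma dmin_le S p q : p \in S -> q \in S -> p != q -> dmin S <= mdist p q.
Proof.
move=> pS qS pq; rewrite /dmin.
apply: le_trans (bigmin_seq_le _ _ _ _ (fun p => \big[Num.min/dmax S]_(q <- S | p != q)
    mdist p q) pS isT) _.
exact: (bigmin_seq_le _ _ _ _ (fun q => mdist p q) qS pq).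
Qed.

Lemma dmin_gt0 S p q : p \in S -> q \in S -> p != q -> 0 < dmin S.
Proof.
move=> pS qS pq.
(* The minimum starts from the default [dmax S], which must therefore be positive as well. *)
have d0 : 0 < dmax S by apply: lt_le_trans (le_dmax _ _ _ pS qS); rewrite mdist_gt0.
apply: (big_ind (fun x => 0 < x)) => // [x y x0 y0|a _].
  by rewrite lt_min x0.
apply: (big_ind (fun x => 0 < x)) => // [x y x0 y0|b ab].
  by rewrite lt_min x0.
by rewrite mdist_gt0.
Qed.

End Distances.

Section CoverTreeTheory.
Context {R : realType} {U : metricType R}.
Variables (S : {fset U}) (T : ctree U).
Hypothesis HT : cover_tree S T.
Implicit Types (l m L : int) (p q x : U) (v : int * U).

Lemma pow2_gt0 l : 0 < (2 : R) ^ l.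
Proof. by rewrite exprz_gt0. Qed.

Lemma pow2S l : (2 : R) ^ (l + 1) = 2 * 2 ^ l.
Proof. by rewrite expfzDr // expr1z mulrC. Qed.

Lemma pow2_mono l m : l <= m -> (2 : R) ^ l <= 2 ^ m.
Proof. by move=> lm; rewrite ler_eXz2l // ltr1n. Qed.

Lemma node_le_root l p : p \in pts T l -> l <= root_level T.
Proof. by move=> pl; rewrite leNgt; apply/negP => /(ct_above HT) E; rewrite E in pl. Qed.

Lemma node_nested l m p : l <= m -> p \in pts T m -> p \in pts T l.
Proof.
move=> lm pm; move: l lm; apply: int_ind_down => // l _ pl.
by have /fsubsetP/(_ _ pl) := ct_nesting HT (l + 1); rewrite addrK.
Qed.

Lemma node_in_set l p : p \in pts T l -> p \in S.
Proof. by move=> pl; have /fsubsetP/(_ _ pl) := ct_sub HT l. Qed.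

(* A parent other than p itself would be too close to p at its own level. *)
Lemma parent_self l p : p \in pts T (l + 1) -> par T l p = p.
Proof.
move=> pl; have pl' : p \in pts T l by apply: node_nested pl; lia.
have lr : l < root_level T by have := node_le_root _ _ pl; clear; lia.
apply/eqP/negPn/negP => ne.
have := ct_separation HT pl (ct_parent HT lr pl'); rewrite eq_sym.
by move=> /(_ ne); rewrite ltNge (ct_covering HT).
Qed.

(** * Ancestors and subtrees *)

Lemma ancestor_node l (j : nat) p :
  p \in pts T l -> l + j%:Z <= root_level T ->
  ancestor T l j p \in pts T (l + j%:Z).
Proof.
elim: j l p => [|j IH] l p pl lr /=; first by rewrite addr0.
have -> : l + j.+1%:Z = l + 1 + j%:Z by clear; lia.
apply: IH; last by move: lr; clear; lia.
by apply: (ct_parent HT) => //; move: lr; clear; lia.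
Qed.

(** The covering bounds 2^(l+1), ..., 2^(l+j) along the path form a geometric sum; keeping the
    subtracted term makes the induction exact. *)
Lemma ancestor_dist l (j : nat) p :
  p \in pts T l -> l + j%:Z <= root_level T ->
  mdist p (ancestor T l j p) <= 2 ^ (l + j%:Z + 1) - 2 ^ (l + 1).
Proof.
elim: j l p => [|j IH] l p pl lr /=; first by rewrite mdistxx addr0 subrr.
have lr' : l < root_level T by move: lr; clear; lia.
apply: le_trans (metric_triangle _ (par T l p) _) _.
have pp := ct_parent HT lr' pl.
have := ct_covering HT lr' pl.
have {IH} := IH _ _ pp; have -> : l + j.+1%:Z = l + 1 + j%:Z by clear; lia.
move=> IH; have {IH} : mdist (par T l p) (ancestor T (l + 1) j (par T l p)) <=
    2 ^ (l + 1 + j%:Z + 1) - 2 ^ (l + 1 + 1) by apply: IH; move: lr; clear; lia.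
by rewrite (pow2S (l + 1)); lra.
Qed.

Lemma ancestor_self l (j : nat) p :
  p \in pts T (l + j%:Z) -> ancestor T l j p = p.
Proof.
elim: j l p => [|j IH] l p pl //=.
have E : l + j.+1%:Z = l + 1 + j%:Z by clear; lia.
rewrite parent_self ?IH -?E //.
by apply: node_nested pl; clear; lia.
Qed.

Lemma ancestor_add l (i j : nat) p :
  ancestor T l (i + j) p = ancestor T (l + i%:Z) j (ancestor T l i p).
Proof.
elim: i l p => [|i IH] l p /=; first by rewrite addr0.
by rewrite IH; congr ancestor; clear; lia.
Qed.

Lemma in_subtree_node L p x : L <= root_level T ->
  in_subtree T L p x -> p \in pts T L.
Proof.
by move=> Lr [j [xj <-]]; have := ancestor_node _ j _ xj; rewrite subrK; apply.
Qed.

Lemma in_subtree_dist L p x : L <= root_level T ->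
  in_subtree T L p x -> mdist x p <= 2 ^ (L + 1).
Proof.
move=> Lr [j [xj <-]]; have := ancestor_dist _ j _ xj; rewrite subrK => /(_ Lr).
by have := pow2_gt0 (L - j%:Z + 1); lra.
Qed.

(** By nesting, [x] is a node on infinitely many levels, so two membership proofs may start from
    different copies. The path up from the lower copy runs through copies of [x] until it reaches
    the higher one, so both paths end at the same ancestor. *)
Lemma in_subtree_uniq L p q x :
  in_subtree T L p x -> in_subtree T L q x -> p = q.
Proof.
suff H i j : (i <= j)%N -> node T (L - i%:Z) x -> node T (L - j%:Z) x ->
    ancestor T (L - i%:Z) i x = ancestor T (L - j%:Z) j x.
  move=> [i [xi <-]] [j [xj <-]].
  by have [ij|/ltnW ij] := leqP i j; [apply: H|apply/esym/H].
move=> ij xi xj; have E : L - i%:Z = L - j%:Z + (j - i)%N%:Z.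
  by move: ij; clear; lia.
have -> : ancestor T (L - j%:Z) j x = ancestor T (L - j%:Z) (j - i + i) x.
  by rewrite subnK.
by rewrite ancestor_add -E (ancestor_self _ (j - i)) // -E.
Qed.

Lemma in_subtree_ex L x : L <= root_level T -> x \in S ->
  exists p, in_subtree T L p x.
Proof.
move=> Lr /(ct_all HT)[l xl].
(* The starting level [L - |L - l|] is below both [L] and [l], so [x] is a node there. *)
exists (ancestor T (L - `|L - l|%N%:Z) `|L - l|%N x), `|L - l|%N; split=> //.
by apply: node_nested xl; clear; lia.
Qed.

Lemma in_subtree_par L p x :
  in_subtree T L p x -> in_subtree T (L + 1) (par T L p) x.
Proof.
move=> [j [xj ej]]; exists j.+1.
have E : L + 1 - j.+1%:Z = L - j%:Z by clear; lia.
by rewrite E; split=> //; rewrite -addn1 ancestor_add ej /= subrK.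
Qed.

(** * Coalesced chains and branching *)

Lemma child_self L p : p \in pts T L -> child T L p p.
Proof.
move=> pL; split; first by apply: node_nested pL; clear; lia.
by apply: parent_self; rewrite subrK.
Qed.

Lemma only_self_childP L p q : only_self_child T (L + 1) p ->
  q \in pts T L -> par T L q = p -> q = p.
Proof. by move=> H qL pq; apply/H; split; rewrite /node addrK. Qed.

(** A coalesced node is the only child of a parent with the same point, so both have the same
    subtree. Hence the weight stored with a chain is correct on every level that the chain
    crosses. *)
Lemma weight_coalesced L p : coalesced T L p ->
  weight S T L p = weight S T (L + 1) p.
Proof.
move=> [Lr pp sc1 _]; congr (#|` _ |)%fset; apply/fsetP => x; rewrite !inE /=.
apply: andb_id2l => xS; apply/asboolP/asboolP => [/in_subtree_par|H].
  by rewrite pp.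
have [q Hq] := in_subtree_ex _ _ (ltW Lr) xS.
have /(in_subtree_uniq _ _ _ _ H) E := in_subtree_par _ _ _ Hq.
suff <- : q = p by [].
by apply: only_self_childP sc1 _ _ => //; apply: in_subtree_node Hq; apply: ltW.
Qed.

(** A node below the root escapes coalescing for one of three reasons: its parent has another point,
    its parent has a second child, or it has a second child itself. Each gives two nodes of level
    [m] or [m - 1] whose distance is bounded below by separation and above by covering. Such pairs
    tie the number of visited levels to the aspect ratio. *)
Lemma explicit_level_pair m q : m < root_level T -> explicit_node T m q ->
  exists a b, [/\ a \in S, b \in S, a != b &
    2 ^ (m - 1) < mdist a b <= 2 ^ (m + 1)].
Proof.
move=> mr [qm nc].
suff [L [a [b [[mL Lm aL bL] [ab e]]]]] : exists L a b,
    [/\ m - 1 <= L, L <= m, a \in pts T L & b \in pts T L] /\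
    (a != b /\ mdist a b <= 2 ^ (L + 1)).
  exists a, b; split=> //; rewrite ?(node_in_set L) //.
  rewrite (le_lt_trans (pow2_mono _ _ mL) (ct_separation HT aL bL ab)).
  by rewrite (le_trans e) //; apply: pow2_mono; rewrite lerD2r.
have br L : q \in pts T (L + 1) -> ~ only_self_child T (L + 1) q ->
    exists b, [/\ q \in pts T L, b \in pts T L, b != q & mdist b q <= 2 ^ (L + 1)].
  move=> qL no; apply: contrapT => Hb; apply: no => b; split; last first.
    by move=> ->; apply: child_self.
  rewrite /child /node addrK => -[bL pb]; apply: contrapT => /eqP bq.
  apply: Hb; exists b; split=> //.
    by apply: node_nested qL; clear; lia.
  rewrite -pb; apply: (ct_covering HT) => //.
  by have := node_le_root _ _ qL; clear; lia.
have [pq|/eqP pq] := EM (par T m q = q); last first.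
  exists m, q, (par T m q); split; last first.
    by split; [rewrite eq_sym|apply: (ct_covering HT)].
  split=> //; first by clear; lia.
  by apply: node_nested (ct_parent HT mr qm); clear; lia.
have qm1 : q \in pts T (m + 1) by rewrite -{1}pq; apply: (ct_parent HT).
have [sc1|/(br _ qm1)[b [H1 H2 H3 H4]]] := EM (only_self_child T (m + 1) q).
  have [sc2|] := EM (only_self_child T m q); first by case: nc.
  have := br (m - 1); rewrite subrK => /(_ qm) H /H[b [H1 H2 H3 H4]].
  by exists (m - 1), b, q; rewrite subrK; split=> //; split=> //; clear; lia.
by exists m, b, q; split=> //; split=> //; clear; lia.
Qed.

(** The level [L] as the program sees it: each node of level [L] is named by the topmost node of the
    coalesced chain through it, which may lie far above [L]. *)
Definition frontier L (fr : seq (int * U)) : Prop :=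
  [/\ uniq (map snd fr), map snd fr =i pts T L &
      forall v, v \in fr -> [/\ explicit_node T v.1 v.2, L <= v.1 &
        forall j, L <= j -> j < v.1 -> coalesced T j v.2]].

Lemma frontier_root p : node T (root_level T) p ->
  frontier (root_level T) [:: (root_level T, p)].
Proof.
move=> pr; split=> //.
- move=> q /=; rewrite inE; apply/eqP/idP => [-> //|qr].
  have /eqP/cardfs1P[x E] := ct_root HT.
  by move: pr qr; rewrite /node E !inE => /eqP -> /eqP ->.
- move=> v; rewrite inE => /eqP -> /=; split=> //.
    by split=> //; case=> + _ _ _; rewrite ltxx.
  by move=> j rj jr; move: (le_lt_trans rj jr); rewrite ltxx.
Qed.

Lemma frontier_perm L s t : perm_eq s t -> frontier L s -> frontier L t.
Proof.
move=> st [us es hs]; split.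
- by rewrite -(perm_uniq (perm_map snd st)).
- by move=> q; rewrite -(perm_mem (perm_map snd st)).
- by move=> v; rewrite -(perm_mem st); apply: hs.
Qed.

Lemma frontier_size L s : frontier L s -> size s = #|` pts T L|.
Proof.
move=> [us es _]; rewrite -(size_map snd) cardfE cardE.
rewrite -(size_map val); apply/perm_size/uniq_perm => //.
  by rewrite map_inj_uniq ?enum_uniq //; apply: val_inj.
move=> q; rewrite es; apply/idP/mapP => [qL|[x _ ->]]; last exact: valP.
by exists [` qL]%fset => //; rewrite mem_enum.
Qed.

Lemma frontier_le_root L s : frontier L s -> (0 < size s)%N ->
  L <= root_level T.
Proof.
case: s => // v s [_ es _] _; apply: (node_le_root _ v.2).
by rewrite -es mem_head.
Qed.

(** The children appear where the chain of [v] ends. If one were higher than another, the lower one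
    would force the chain to pass through the level of the higher one, which would then be coalesced
    itself. Thus the first child alone tells the level of all siblings. *)
Lemma explicit_child_level v m q m' q' :
  explicit_child T v.1 v.2 m q -> explicit_child T v.1 v.2 m' q' -> m = m'.
Proof.
wlog mm' : m q m' q' / m <= m'.
  move=> H H1 H2; have [mm|mm] := lerP m m'; first exact: H H1 H2.
  by apply/esym; apply: H H2 H1; apply: ltW.
rewrite le_eqVlt in mm'; case/predU1P: mm' => // mm' H1 [[qm' nc'] m'l p' _].
case: H1 => _ ml _ /(_ m'); rewrite lezD1 => /(_ mm' m'l) co.
case: nc'; suff -> : q' = v.2 by [].
by case: co => _ _ sc1 _; apply: only_self_childP sc1 _ p'.
Qed.

Lemma frontier_child_lt L fr v m q : frontier L fr -> v \in fr ->
  explicit_child T v.1 v.2 m q -> m < L.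
Proof.
move=> [_ _ /(_ v) fP] /fP[_ _ ch] [[qm nc] ml pm _].
rewrite ltNge; apply/negP => Lm; have co := ch _ Lm ml; case: nc.
suff -> : q = v.2 by [].
by case: co => _ _ sc1 _; apply: only_self_childP sc1 _ pm.
Qed.

(** By nesting the same-point child at level [L] always exists; were it not coalesced, it would be
    an explicit child at that level. *)
Lemma chain_next L fr v : frontier (L + 1) fr -> v \in fr ->
  (forall q, ~ explicit_child T v.1 v.2 L q) -> coalesced T L v.2.
Proof.
move=> [_ es /(_ v) fP] vfr nch; have [ev Lv ch] := fP vfr.
have vL : v.2 \in pts T (L + 1) by rewrite -es; apply: map_f.
apply: contrapT => nc; apply: (nch v.2); split=> //.
- by split=> //; apply: node_nested vL; clear; lia.
- by move: Lv; clear; lia.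
- exact: parent_self.
Qed.

Lemma frontier_step L fr : frontier (L + 1) fr ->
  (forall v m q, v \in fr -> explicit_child T v.1 v.2 m q -> m < L) ->
  (0 < size fr)%N -> frontier L fr.
Proof.
move=> F nch s0; have [us es fP] := F.
have Lr : L < root_level T by have := frontier_le_root _ _ F s0; clear; lia.
have co v : v \in fr -> coalesced T L v.2.
  move=> vfr; apply: (chain_next _ _ _ F vfr) => q /(nch _ _ _ vfr).
  by rewrite ltxx.
split=> //.
- move=> q; apply/idP/idP => [|qL].
    by rewrite es; apply: node_nested; clear; lia.
  have := ct_parent HT Lr qL; rewrite -es => /mapP[v vfr pv].
  suff -> : q = v.2 by apply: map_f.
  by have [_ _ sc1 _] := co _ vfr; apply: only_self_childP sc1 _ _.
- move=> v vfr; have [ev Lv ch] := fP _ vfr; split=> //.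
    by move: Lv; clear; lia.
  move=> j; rewrite le_eqVlt => /predU1P[<- _|Lj jv]; first exact: co.
  by apply: ch => //; rewrite lezD1.
Qed.

(** Levels at which no chain ends cost nothing: one list names all of them. *)
Lemma frontier_down L L' fr : frontier L fr -> L' <= L ->
  (forall v m q, v \in fr -> explicit_child T v.1 v.2 m q -> m < L') ->
  (0 < size fr)%N -> frontier L' fr.
Proof.
move=> F LL nch s0.
suff H l : l <= L -> L' <= l -> frontier l fr by apply: H.
move: l; apply: int_ind_down => // l lL IH Ll; apply: frontier_step => //.
  by apply: IH; move: Ll; clear; lia.
by move=> v m q vfr /(nch _ _ _ vfr) mL; apply: lt_le_trans mL Ll.
Qed.

Lemma frontier_weight L fr v : frontier L fr -> v \in fr ->
  weight S T v.1 v.2 = weight S T L v.2.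
Proof.
move=> [_ _ /(_ v) fP] /fP[_ Lv ch].
suff H l : l <= v.1 -> L <= l -> weight S T v.1 v.2 = weight S T l v.2.
  exact: H.
move: l; apply: int_ind_down => // l lv IH Ll.
rewrite (weight_coalesced l); last exact: ch.
by apply: IH; move: Ll; clear; lia.
Qed.

(** The part of level [m] below [v]: its children if its chain ends just above [m], and otherwise
    [v] itself, whose chain goes on. Siblings share a level, so testing the first child suffices. *)
Definition new_kids (kids : int * U -> seq (int * U)) m v :=
  if kids v is w :: _ then if w.1 == m then kids v else [:: v] else [:: v].

Lemma frontier_expand kids m fr : frontier (m + 1) fr ->
  (forall v, v \in fr -> uniq (kids v) /\
     forall l q, (l, q) \in kids v <-> explicit_child T v.1 v.2 l q) ->
  (0 < size fr)%N -> frontier m (flatten (map (new_kids kids m) fr)).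
Proof.
move=> F kP s0; have [us es fP] := F.
have mr : m < root_level T by have := frontier_le_root _ _ F s0; clear; lia.
have vm v : v \in fr -> v.2 \in pts T (m + 1) by move=> vfr; rewrite -es map_f.
have nkP v : v \in fr ->
    ((forall w, w \in kids v -> w.1 = m) /\ new_kids kids m v = kids v /\
       exists q, explicit_child T v.1 v.2 m q) \/
    ((forall q, ~ explicit_child T v.1 v.2 m q) /\ new_kids kids m v = [:: v]).
  move=> vfr; have [_ kv] := kP _ vfr; rewrite /new_kids.
  case E : (kids v) => [|w s].
    by right; split=> // q /kv; rewrite E.
  have /kv ew : (w.1, w.2) \in kids v by rewrite -surjective_pairing E mem_head.
  case: eqP => [wm|wm]; [left|right]; split.
  - move=> [a b]; rewrite -E => /kv eu.
    by rewrite -wm; apply: explicit_child_level eu ew.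
  - by split=> //; exists w.2; rewrite -wm.
  - by move=> q eq; apply: wm; apply: explicit_child_level ew eq.
  - by [].
have kmem v q : v \in fr -> q \in pts T m -> par T m q = v.2 ->
    q \in map snd (new_kids kids m v).
  move=> vfr qm pq; have [_ _ ch] := fP _ vfr.
  case: (nkP _ vfr) => [[kw [-> [q0 e0]]]|[nc ->]].
    have [_ kv] := kP _ vfr; apply/mapP; exists (m, q) => //.
    case: (e0) => [[q0m nc0] mv pq0 ch0].
    (* If [q] were coalesced, it would be the point of [v] and the only child there, so the explicit
       child [q0] would be [q], a contradiction. *)
    apply/kv; split=> //; split=> // -[_ pq' sc1 sc2].
    have qv : v.2 = q by rewrite -pq pq'.
    have E : q0 = q by apply: only_self_childP sc1 q0m _; rewrite pq0.
    by rewrite E in nc0; apply: nc0.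
  have [_ _ sc1 _] := chain_next _ _ _ F vfr nc.
  by rewrite mem_seq1; apply/eqP; apply: only_self_childP sc1 _ _.
have kpar v q : v \in fr -> q \in map snd (new_kids kids m v) ->
    q \in pts T m /\ par T m q = v.2.
  move=> vfr; case: (nkP _ vfr) => [[kw [-> _]]|[nc ->]].
    move=> /mapP[[l b] bk -> /=]; have /= E := kw _ bk; rewrite E in bk.
    by have [_ kv] := kP _ vfr; case/kv: bk => [[]].
  rewrite mem_seq1 => /eqP ->; split; last exact: parent_self (vm _ vfr).
  by apply: node_nested (vm _ vfr); clear; lia.
rewrite /frontier map_flatten -map_comp; split.
- apply: (uniq_flatten_map _ _ _ _ (par T m) snd) => // [v vfr|v q vfr].
    case: (nkP _ vfr) => [[kw [/= -> _]]|[_ /= -> //]].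
    have [uk _] := kP _ vfr; rewrite map_inj_in_uniq // => -[a b] [a' b'].
    by move=> /kw /= -> /kw /= -> /= ->.
  by move=> /= /(kpar _ _ vfr)[].
- move=> q; apply/flatten_mapP/idP => [[v vfr /(kpar _ _ vfr)[]//]|qm].
  have := ct_parent HT mr qm; rewrite -es => /mapP[v vfr pv].
  by exists v => //=; apply: kmem.
- move=> u /flatten_mapP[v vfr]; have [ev mv ch] := fP _ vfr.
  case: (nkP _ vfr) => [[kw [-> _]]|[nc ->]].
    case: u => a b ub; have /= E := kw _ ub; rewrite E in ub *.
    have [_ kv] := kP _ vfr; case/kv: ub => ex _ _ _; split=> //= j mj jm.
    by move: (le_lt_trans mj jm); rewrite ltxx.
  rewrite inE => /eqP ->; split=> //; first by move: mv; clear; lia.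
  move=> j; rewrite le_eqVlt => /predU1P[<- _|mj jv].
    exact: chain_next F vfr nc.
  by apply: ch => //; rewrite lezD1.
Qed.

(** Level sizes grow from 1 at the root until all points of the finite set [S] are present; [l] is
    the first level with more than [K] nodes. *)
Lemma level_of_count (K : nat) : (0 < K)%N -> (K < #|` S|)%N ->
  exists2 l, l < root_level T &
    (#|` pts T (l + 1)| <= K)%N /\ (K < #|` pts T l|)%N.
Proof.
move=> K0 KS.
have [L LS] : exists L, {subset (S : seq U) <= pts T L}.
  have : {subset (S : seq U) <= S} by [].
  elim: {1 2}(S : seq U) => [|x s IH] sS; first by exists 0.
  have [|L Ls] := IH; first by move=> y ys; apply: sS; rewrite inE ys orbT.
  have [l xl] := ct_all HT (sS _ (mem_head _ _)).
  exists (Num.min L l) => y; rewrite inE => /predU1P[->|/Ls].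
    by apply: node_nested xl; rewrite ge_min lexx orbT.
  by apply: node_nested; rewrite ge_min lexx.
have ex : exists n : nat, (K < #|` pts T (root_level T - n%:Z)|)%N.
  exists `|root_level T - L|%N; apply: leq_trans KS _.
  apply: fsubset_leq_card; apply/fsubsetP => x /LS.
  by apply: node_nested; clear; lia.
case: (ex_minnP ex) => -[|n] Hn mn.
  by move: Hn; rewrite subr0 (ct_root HT); move: K0; clear; lia.
exists (root_level T - n.+1%:Z); first by clear; lia.
split=> //; have -> : root_level T - n.+1%:Z + 1 = root_level T - n%:Z.
  by clear; lia.
by rewrite leqNgt; apply/negP => /mn; rewrite ltnn.
Qed.

(** * Sizes of levels in a doubling space *)

Lemma card_nested l m : l <= m -> (#|` pts T m| <= #|` pts T l|)%N.
Proof. by move=> lm; apply/fsubset_leq_card/fsubsetP => x; apply: node_nested. Qed.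

Lemma doubling_iter (D : R) (h : nat) p (r : R) : doubling (U := U) D ->
  exists2 X : seq U, (size X)%:R <= (2 `^ D) ^+ h &
    forall q, mdist p q <= r -> exists2 x, x \in X & mdist x q <= r / 2 ^+ h.
Proof.
move=> dD; elim: h p r => [|h IH] p r.
  by exists [:: p] => // q pq; exists p; rewrite ?mem_head // expr0 divr1.
have [X sX cX] := dD p r.
pose Y := fun x => sval (cid2 (IH x (r / 2))).
have [sY cY] : (forall x, (size (Y x))%:R <= (2 `^ D) ^+ h) /\
    (forall x q, mdist x q <= r / 2 ->
       exists2 y, y \in Y x & mdist y q <= (r / 2) / 2 ^+ h).
  by split=> x; rewrite /Y; case: cid2.
exists (flatten (map Y X)).
  apply: (@le_trans _ _ ((size X)%:R * (2 `^ D) ^+ h)); last first.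
    by rewrite exprS ler_wpM2r // exprn_ge0 // powR_ge0.
  elim: X {sX cX} => [|x X IHX] /=; first by rewrite mul0r.
  by rewrite size_cat natrD -add1n natrD mulrDl mul1r lerD.
move=> q /cX[x xX /cY[y yY d]]; exists y; first by apply/flatten_mapP; exists x.
by rewrite exprS invfM mulrA.
Qed.

(** Every node of level [l - j] lies within 2^(l+2) of its ancestor on level [l + 1]. Halving these
    balls [j + 3] times gives radius 2^(l-j-1), and such a small ball holds at most one node of
    level [l - j], because two would be within 2^(l-j) of each other. *)
Lemma card_level_le (D : R) l (j : nat) : doubling (U := U) D ->
  l + 1 <= root_level T ->
  (#|` pts T (l - j%:Z)|)%:R <= (#|` pts T (l + 1)|)%:R * (2 `^ D) ^+ (j + 3) :> R.
Proof.
move=> dD lr.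
pose Y p := sval (cid2 (doubling_iter _ (j + 3) p (2 ^ (l + 2)) dD)).
have sY p : (size (Y p))%:R <= (2 `^ D) ^+ (j + 3) by rewrite /Y; case: cid2.
have E : (2 : R) ^ (l + 2) / 2 ^+ (j + 3) = 2 ^ (l - j%:Z - 1).
  rewrite -[_ ^+ _]/(_ ^ (j + 3)%N%:Z) invr_expz -expfzDr //.
  by congr exprz; clear; lia.
have cY p q : mdist p q <= 2 ^ (l + 2) ->
    exists2 y, y \in Y p & mdist y q <= 2 ^ (l - j%:Z - 1).
  by rewrite -E /Y; case: cid2 => X /= _ H /H.
pose Z := flatten (map Y (pts T (l + 1) : seq U)).
have cover q : q \in pts T (l - j%:Z) ->
    exists y, y \in Z /\ mdist y q <= 2 ^ (l - j%:Z - 1).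
  move=> qj; have [p pq] := in_subtree_ex _ _ lr (node_in_set _ _ qj).
  have pl := in_subtree_node _ _ _ lr pq.
  have := in_subtree_dist _ _ _ lr pq.
  rewrite metric_sym -addrA => /cY[y yY d]; exists y; split=> //.
  by apply/flatten_mapP; exists p.
pose f q := xget q [set y | y \in Z /\ mdist y q <= 2 ^ (l - j%:Z - 1)]%classic.
have fP q : q \in pts T (l - j%:Z) ->
    f q \in Z /\ mdist (f q) q <= 2 ^ (l - j%:Z - 1).
  by move=> /cover H; apply: (xgetPex q H).
have H : (#|` pts T (l - j%:Z)| <= size Z)%N.
  rewrite -(size_map f (pts T (l - j%:Z))); apply: uniq_leq_size; last first.
    by move=> _ /mapP[q qj ->]; case: (fP _ qj).
  rewrite map_inj_in_uniq ?fset_uniq // => a b aj bj ab.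
  apply/eqP/negPn/negP => /(ct_separation HT aj bj).
  rewrite ltNge; apply/negP; rewrite negbK.
  apply: le_trans (metric_triangle _ (f a) _) _.
  have [_ da] := fP _ aj; have [_ db] := fP _ bj; rewrite -ab in db.
  rewrite metric_sym in da; have := pow2S (l - j%:Z - 1); rewrite subrK.
  by move: da db; lra.
apply: le_trans (_ : (size Z)%:R <= _); first by rewrite ler_nat.
rewrite /Z; elim: (pts T (l + 1) : seq U) => [|x s IH] /=; first by rewrite mul0r.
by rewrite size_cat natrD -(add1n (size s)) natrD mulrDl mul1r lerD.
Qed.

End CoverTreeTheory.

(** * Clustering with outliers *)

Lemma leq_count_add (X : eqType) (a b c d : pred X) (s : seq X) :
  (forall x, x \in s -> a x + b x <= c x + d x)%N ->
  (count a s + count b s <= count c s + count d s)%N.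
Proof.
elim: s => //= x s IH H; have := H x (mem_head _ _).
have {IH} : (count a s + count b s <= count c s + count d s)%N.
  by apply: IH => y ys; apply: H; rewrite inE ys orbT.
by clear; move: (count _ _) (count _ _) (count _ _) (count _ _); lia.
Qed.

Lemma leq_count_in (X : eqType) (a b : pred X) (s : seq X) :
  (forall x, x \in s -> a x -> b x) -> (count a s <= count b s)%N.
Proof.
move=> H; have := leq_count_add _ a pred0 b pred0 s.
rewrite !count_pred0 !addn0; apply=> x xs /=; rewrite !addn0.
by case: (a x) (H x xs) => // ->.
Qed.

Lemma card_fset_filter (X : choiceType) (A : {fset X}) (P : pred X) :
  #|` [fset x in A | P x]%fset| = count P A.
Proof.
rewrite -size_filter; apply/perm_size/uniq_perm => //.
  by rewrite filter_uniq.
by move=> x; rewrite mem_filter !inE /= andbC.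
Qed.

Lemma count_fibers (X Y : eqType) (f : X -> Y) (s : seq X) (ys : seq Y)
    (P : pred Y) :
  uniq ys -> (forall x, x \in s -> f x \in ys) ->
  count (fun x => P (f x)) s =
  (\sum_(y <- ys | P y) count (fun x => f x == y) s)%N.
Proof.
move=> uy; elim: s => [|x s IH] fs /=; first by rewrite big1.
rewrite IH => [|z zs]; last by apply: fs; rewrite inE zs orbT.
rewrite big_split /=; congr addn; have fx := fs x (mem_head _ _).
rewrite big_mkcond (bigD1_seq (f x)) //= eqxx big1 ?addn0; last first.
  by move=> y /negbTE yf; rewrite eq_sym yf; case: ifP.
by case: (P _).
Qed.

Section Clustering.
Context {R : realType} {U : metricType R}.
Implicit Types (S C : {fset U}) (r t rho eta : R).

Definition near_some r (cs : seq U) : pred U :=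
  fun x => has (fun c => mdist x c <= r) cs.

Lemma dist_to_le C p t : (dist_to C p <= t%:E)%E = near_some t C p.
Proof.
apply/idP/hasP => [|[q qC d]]; last first.
  apply: le_trans (bigmin_seq_le _ _ q _ (fun q => (mdist p q)%:E) qC isT) _.
  by rewrite lee_fin.
rewrite /dist_to.
have [->//|[q [qC _ ->]]] := bigmin_seq_attained +oo%E (enum_fset C) predT
  (fun q => (mdist p q)%:E).
by rewrite lee_fin => d; exists q.
Qed.

Lemma radius_ge0 C (X : {fset U}) : (0%:E <= Defs.radius C X)%E.
Proof.
rewrite /Defs.radius; elim: (X : seq U) => [|x s IH]; rewrite ?big_nil // big_cons.
by rewrite le_max IH orbT.
Qed.

(** A non-outlier farther than [t] comes after [z] points at least as far in the sorted list, which
    makes [z + 1] points beyond [t]. With the converse below, the outlier radius is handled from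
    here on only through counts of points far from [C]. *)
Lemma outlier_radius_le S z C t : 0 <= t ->
  (count (predC (near_some t C)) S <= z)%N ->
  (outlier_radius S z C <= t%:E)%E.
Proof.
move=> t0 cz; rewrite /outlier_radius /Defs.radius big_seq.
apply: (big_ind (fun x => x <= t%:E)%E) => [|x y xt yt|p].
- by rewrite lee_fin.
- by rewrite ge_max xt.
rewrite inE /outliers seq_fsetE => /andP[pn pS].
set leT := (fun p q => _) in pn; set s := sort leT _ in pn.
rewrite leNgt; apply/negP => tp.
have ps : p \in drop z s.
  have : p \in s by rewrite mem_sort.
  by rewrite -[s in p \in s](cat_take_drop z) mem_cat (negbTE pn).
have pw : pairwise leT s.
  rewrite -sorted_pairwise; first by apply: sort_sorted => a b; apply: le_total.
  by move=> a b c /= ba cb; apply: le_trans cb ba.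
move: pw; rewrite -(cat_take_drop z s) pairwise_cat => /and3P[/allrelP al _ _].
have : (z < count (predC (near_some t C)) s)%N.
  rewrite -(cat_take_drop z s) count_cat -addn1 leq_add //; last first.
    by rewrite -has_count; apply/hasP; exists p => //=; rewrite -dist_to_le -ltNge.
  have {1}<- : size (take z s) = z.
    by rewrite size_takel //; apply/ltnW; rewrite -subn_gt0 -size_drop; case: drop ps.
  rewrite -count_predT; apply: leq_count_in => q qs _ /=.
  by rewrite -dist_to_le -ltNge; apply: lt_le_trans tp _; apply: al.
by rewrite count_sort ltnNge cz.
Qed.

(** All points beyond [t] must be outliers, and these are at most [z]. *)
Lemma outlier_radius_count S z C t : (outlier_radius S z C <= t%:E)%E ->
  (count (predC (near_some t C)) S <= z)%N.
Proof.
move=> Ht; rewrite -size_filter; set s := sort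
  (fun p q => (dist_to C q <= dist_to C p)%E) (enum_fset S).
apply: (@leq_trans (size (take z s))); last by rewrite size_take_min geq_minl.
apply: uniq_leq_size; first by apply/filter_uniq/fset_uniq.
move=> p; rewrite mem_filter /= => /andP[np pS].
apply/negPn/negP => pn; move/negP: np; apply.
rewrite -dist_to_le; apply: le_trans _ Ht; rewrite /outlier_radius /Defs.radius.
apply: (le_bigmax_seq _ p predT (fun p => dist_to C p)) => //.
by rewrite inE /outliers seq_fsetE pS andbT.
Qed.

Lemma opt_radiusP S (k z : nat) : (0 < k)%N -> (0 < #|` S|)%N ->
  exists r (C : {fset U}), [/\ opt_radius S k z = r%:E, 0 <= r <= dmax S,
    (C `<=` S)%fset, (#|` C| <= k)%N & (count (predC (near_some r C)) S <= z)%N].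
Proof.
move=> k0; rewrite cardfs_gt0 => /fset0Pn[p pS].
have le : (opt_radius S k z <= (dmax S)%:E)%E.
  (* A single center already reaches every point within [dmax S], so the optimum is finite. *)
  apply: le_trans (bigmin_seq_le _ _ [fset p]%fset _ _ _ _) _.
  - by rewrite fpowersetE fsub1set.
  - by rewrite cardfs1.
  apply: outlier_radius_le; first exact: dmax_ge0.
  rewrite (@eq_in_count _ _ pred0) ?count_pred0 // => x xS /=.
  apply/negbF/hasP; exists p; first by rewrite inE.
  exact: le_dmax.
have := bigmin_seq_attained +oo%E (enum_fset (fpowerset S))
  (fun C => (#|` C| <= k)%N) (outlier_radius S z).
rewrite -/(opt_radius S k z) => -[E|[C [CS Ck E]]]; first by rewrite E in le.
have := radius_ge0 C (S `\` outliers S z C)%fset.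
rewrite -/(outlier_radius S z C) -E => ge.
case: (opt_radius S k z) E le ge => // r E; rewrite !lee_fin => le ge.
exists r, C; split=> //; first by rewrite ge le.
  by rewrite -fpowersetE.
by apply: outlier_radius_count; rewrite -E.
Qed.

(* More than k + z separated points leave two non-outliers with a common
   center. *)
Lemma packing_lower_bound S (Q C : seq U) (k z : nat) r (d : R) :
  (count (predC (near_some r C)) S <= z)%N -> (size C <= k)%N ->
  uniq Q -> {subset Q <= S} -> (k + z < size Q)%N ->
  {in Q &, forall a b, a != b -> d < mdist a b} -> d < 2 * r.
Proof.
move=> cz Ck uQ QS szQ sep; rewrite ltNge; apply/negP => rd.
pose f x := nth x C (find (fun c => mdist x c <= r) C).
have fP x : near_some r C x -> f x \in C /\ mdist x (f x) <= r.
  by move=> nx; split; [rewrite mem_nth // -has_find|apply: (nth_find x nx)].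
have : (size [seq x <- Q | near_some r C x] <= k)%N.
  apply: leq_trans Ck; rewrite -(size_map f); apply: uniq_leq_size; last first.
    by move=> _ /mapP[x + ->]; rewrite mem_filter => /andP[/fP[]].
  rewrite map_inj_in_uniq ?filter_uniq // => a b.
  rewrite !mem_filter => /andP[/fP[_ da] aQ] /andP[/fP[_ db] bQ] ab.
  apply/eqP/negPn/negP => /(sep _ _ aQ bQ); rewrite ltNge => /negP; apply.
  apply: le_trans (metric_triangle _ (f a) _) _.
  by rewrite (metric_sym b) -ab in db; move: da db rd; lra.
rewrite size_filter => nQ.
have : (count (predC (near_some r C)) Q <= z)%N.
  apply: leq_trans cz; rewrite -!size_filter; apply: uniq_leq_size.
    by rewrite filter_uniq.
  by move=> x; rewrite !mem_filter => /andP[-> /QS].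
have := count_predC (near_some r C) Q.
by move: nQ szQ; clear; move: (count _ _) (count _ _); lia.
Qed.

(** The count kept at most [z] is that of points neither covered nor in a remaining optimal cluster,
    and each step gives up one cluster. A cluster met by the new ball is covered by the tripled
    ball, so giving it up is free. If none is met, an arbitrary one is given up: this exposes at
    most the uncovered weight of a competing ball, and the new ball removes at least as much from
    the count, since its points lie in no remaining cluster. *)
Lemma greedy_step (s Q cs : seq U) (pi : U -> U) (cov : pred U) (q : U) r rho (z : nat) :
  0 <= rho ->
  (forall b, b \in Q ->
     (count (fun x => (mdist b (pi x) <= rho)%R && ~~ cov (pi x)) s <=
      count (fun x => (mdist q (pi x) <= rho)%R && ~~ cov (pi x)) s)%N) ->
  (forall c, c \in cs -> exists2 b, b \in Q &
     forall x, x \in s -> mdist x c <= r -> mdist b (pi x) <= rho) ->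
  (count (fun x => ~~ cov (pi x) && ~~ near_some r cs x) s <= z)%N ->
  exists cs', [/\ {subset cs' <= cs}, (size cs' <= (size cs).-1)%N &
    (count (fun x => ~~ (cov (pi x) || (mdist q (pi x) <= 3 * rho)%R) &&
                     ~~ near_some r cs' x) s <= z)%N].
Proof.
move=> rho0 qmax cb cz.
case: (boolP (has (fun x => [&& ~~ cov (pi x), mdist q (pi x) <= rho &
    near_some r cs x]) s)).
  move=> /hasP[x xs /and3P[Ax Bx /hasP[c ccs dc]]].
  exists (rem c cs); split; first exact: mem_rem.
    by rewrite size_rem.
  apply: leq_trans cz; apply: leq_count_in => y ys.
  rewrite negb_or => /andP[/andP[-> Ey] ny] /=.
  apply: contra ny => /hasP[c' cc' dy]; apply/hasP; exists c' => //.
  move: cc' dy; rewrite (perm_mem (perm_to_rem ccs)) inE.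
  move=> /predU1P[-> dy|//]; case/negP: Ey.
  have [b bQ Hb] := cb c ccs.
  (* The path from [q] through [pi x] and [b] to [pi y] has three legs of length at most [rho]. *)
  have := Hb x xs dc; have := Hb y ys dy; rewrite (metric_sym b (pi x)).
  have := metric_triangle q (pi x) (pi y).
  have := metric_triangle (pi x) b (pi y).
  by move: Bx; lra.
move=> /hasPn disj; case: cs cb cz disj => [|c cs] cb cz disj.
  exists [::]; split=> //; apply: leq_trans cz; apply: leq_count_in => x xs.
  by rewrite negb_or => /andP[/andP[->]].
exists cs; split=> //; first by move=> x xs; rewrite inE xs orbT.
have [b bQ Hb] := cb c (mem_head _ _).
(* The chosen ball avoids the remaining clusters, so all its uncovered points leave the count. *)
have H1 : (count (fun x => ~~ (cov (pi x) || (mdist q (pi x) <= 3 * rho)%R) &&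
    ~~ near_some r cs x) s +
    count (fun x => (mdist q (pi x) <= rho)%R && ~~ cov (pi x)) s <=
    count (fun x => ~~ cov (pi x) && ~~ near_some r cs x) s + count pred0 s)%N.
  apply: leq_count_add => x xs /=; rewrite addn0; have := disj x xs.
  case: (cov (pi x)) => //=; rewrite ?andbF //.
  case: (boolP (mdist q (pi x) <= rho)) => [qx|_] /=; last first.
    by case: (_ <= _); case: (near_some _ _ _).
  rewrite /near_some /= negb_or => /andP[_ ->].
  by have -> : mdist q (pi x) <= 3 * rho by move: qx rho0; lra.
(* Giving up [c] exposes only points whose proxies lie in the ball around [b]. *)
have H2 : (count (fun x => ~~ cov (pi x) && ~~ near_some r cs x) s + count pred0 s <=
    count (fun x => ~~ cov (pi x) && ~~ near_some r (c :: cs) x) s +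
    count (fun x => (mdist b (pi x) <= rho)%R && ~~ cov (pi x)) s)%N.
  apply: leq_count_add => x xs /=; rewrite addn0; have := Hb x xs.
  case: (cov (pi x)) => //=; rewrite /near_some /=.
  by case: (_ <= r) => [->|_] //=; case: has.
have := qmax b bQ; move: H1 H2 cz; clear; rewrite count_pred0.
by do 5!move: (count _ _) => ?; lia.
Qed.

End Clustering.

(** The proxy of a point is its unique ancestor on level [L], so the fibers of [pi] are the sets
    counted by the weights. *)
Lemma proxy_map {R : realType} {U : metricType R} (S : {fset U}) (T : ctree U)
    (L : int) : cover_tree S T -> L <= root_level T ->
  exists pi : U -> U,
    (forall x, x \in S -> pi x \in pts T L /\ mdist x (pi x) <= 2 ^ (L + 1)) /\
    forall p, weight S T L p = count (fun x => pi x == p) S.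
Proof.
move=> HT Lr.
have ex (x : U) : exists p, x \in S -> in_subtree T L p x.
  have [xS|] := boolP (x \in S); last by exists x.
  by have [p] := in_subtree_ex _ _ HT _ _ Lr xS; exists p.
pose pi x := sval (cid (ex x)).
have piP x : x \in S -> in_subtree T L (pi x) x by rewrite /pi; case: cid.
exists pi; split=> [x xS|p].
  split; first exact: (in_subtree_node _ _ HT _ _ _ Lr (piP _ xS)).
  exact: (in_subtree_dist _ _ HT _ _ _ Lr (piP _ xS)).
rewrite /weight card_fset_filter; apply: eq_in_count => x xS.
apply/asboolP/eqP => [|<-]; last exact: piP.
exact: (in_subtree_uniq _ _ HT _ _ _ _ (piP _ xS)).
Qed.

(** * The algorithm *)

Section Program.

Local Notation cst c := (IConst c).
Local Notation var v := (IGet v (IConst 0)).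
Local Notation rvar v := (RGet v (IConst 0)).
Local Notation "v ::= e" := (ISet v (IConst 0) e) (at level 80).
Local Notation "v r:= e" := (RSet v (IConst 0) e) (at level 80).
Local Notation "c ;; d" := (Seq c d) (at level 90, right associativity).
Local Notation point v := (PGet 0 (IGet 6 (var v))).

(* Integer arrays: 6 frontier (addresses), 7 weights of the uncovered proxies,
   8 weights of the balls of radius rho.  Integer variables: 10 size of the
   frontier, 11 and 20 loop counters, 12 next level, 13 "some node has a
   child", 14 target level, 15 depth j, 16 list pointer, 17 old size of the
   frontier, 18 index of the heaviest ball, 19 number of centers, 21 uncovered
   weight.  Real variables: 1 min(eps,1), 2 the power 2^j, 3 distance between
   two siblings, 4 guess r, 5 ball radius rho. *)

Definition depth_prog : cmd :=
  If (RLe (rvar 0) (RInt (cst 1))) (1 r:= rvar 0) (1 r:= RInt (cst 1)) ;;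
  15 ::= cst 0 ;;
  2 r:= RInt (cst 1) ;;
  While (BNot (RLe (RInt (cst 4)) (RMul (rvar 2) (rvar 1))))
    (2 r:= RAdd (rvar 2) (rvar 2) ;;
     15 ::= IAdd (var 15) (cst 1)).

(** One pass leaves in variable 12 the highest level on which a frontier node has children, the next
    level at which the list changes. *)
Definition scan_body : cmd :=
  16 ::= IGet 3 (IGet 6 (var 11)) ;;
  If (BAnd (ILe (cst 0) (var 16))
           (BNot (BAnd (ILe (cst 1) (var 13)) (ILe (IGet 0 (var 16)) (var 12)))))
    (12 ::= IGet 0 (var 16) ;; 13 ::= cst 1)
    Skip.

(** Position [var 11] already holds the first child, so real variable 3 receives a distance between
    two siblings. It is overwritten for each further sibling, as any pair serves as a scale. *)
Definition append_prog : cmd :=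
  While (ILe (cst 0) (var 16))
    (ISet 6 (var 10) (var 16) ;;
     3 r:= RDist (point 11) (PGet 0 (var 16)) ;;
     10 ::= IAdd (var 10) (cst 1) ;;
     16 ::= IGet 4 (var 16)).

(** The first child takes the place of its parent and the other children go to the end of the list.
    The list grows during the pass, whose bound is therefore the old size in variable 17. *)
Definition expand_body : cmd :=
  16 ::= IGet 3 (IGet 6 (var 11)) ;;
  If (BAnd (ILe (cst 0) (var 16)) (ILe (var 12) (IGet 0 (var 16))))
    (ISet 6 (var 11) (var 16) ;; 16 ::= IGet 4 (var 16) ;; append_prog)
    Skip.

(** While the list is short, the target is reset to [j] levels below the next visited level. The
    last reset happens just before the list outgrows [k + z], hence at the visit of level [l], and
    leaves the target [l - j]. *)
Definition descend_body : cmd :=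
  13 ::= cst 0 ;;
  for_loop 11 10 0 scan_body ;;
  If (ILe (var 10) (IAdd (IGet 5 (cst 1)) (IGet 5 (cst 2))))
    (14 ::= ISub (var 12) (var 15)) Skip ;;
  If (BAnd (ILe (cst 1) (var 13)) (ILe (var 14) (var 12)))
    (17 ::= var 10 ;; for_loop 11 17 0 expand_body)
    (13 ::= cst 0).

Definition descend_prog : cmd :=
  ISet 6 (cst 0) (IGet 5 (cst 0)) ;;
  10 ::= cst 1 ;;
  13 ::= cst 1 ;;
  While (ILe (cst 1) (var 13)) descend_body.

Definition ball_body : cmd :=
  If (RLe (RDist (point 11) (point 20)) (rvar 5))
    (ISet 8 (var 11) (IAdd (IGet 8 (var 11)) (IGet 1 (IGet 6 (var 20)))))
    Skip.

Definition weigh_body : cmd :=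
  ISet 7 (var 11) (IGet 1 (IGet 6 (var 11))) ;;
  ISet 8 (var 11) (cst 0) ;;
  21 ::= IAdd (var 21) (IGet 1 (IGet 6 (var 11))) ;;
  for_loop 20 10 0 ball_body.

Definition pick_body : cmd :=
  If (ILe (IGet 8 (var 18)) (IGet 8 (var 11))) (18 ::= var 11) Skip.

Definition discount_body : cmd :=
  If (RLe (RDist (point 11) (point 20)) (rvar 5))
    (ISet 8 (var 11) (ISub (IGet 8 (var 11)) (IGet 7 (var 20))))
    Skip.

Definition cover_body : cmd :=
  If (BAnd (ILe (cst 1) (IGet 7 (var 20)))
           (RLe (RDist (point 18) (point 20)) (RMul (RInt (cst 3)) (rvar 5))))
    (for_loop 11 10 0 discount_body ;;
     21 ::= ISub (var 21) (IGet 7 (var 20)) ;;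
     ISet 7 (var 20) (cst 0))
    Skip.

Definition greedy_body : cmd :=
  18 ::= cst 0 ;;
  for_loop 11 10 0 pick_body ;;
  PSet 1 (var 19) (point 18) ;;
  for_loop 20 10 0 cover_body.

Definition guess_body : cmd :=
  5 r:= RMul (RAdd (RInt (cst 1)) (RAdd (rvar 1) (rvar 1))) (rvar 4) ;;
  21 ::= cst 0 ;;
  for_loop 11 10 0 weigh_body ;;
  for_loop 19 5 1 greedy_body ;;
  4 r:= RMul (rvar 4) (RAdd (RInt (cst 1)) (rvar 1)).

(** The initial value [z + 1] of variable 21 forces a first guess. *)
Definition search_prog : cmd :=
  4 r:= RDiv (rvar 3) (RInt (cst 8)) ;;
  21 ::= IAdd (IGet 5 (cst 2)) (cst 1) ;;
  While (ILe (IAdd (IGet 5 (cst 2)) (cst 1)) (var 21)) guess_body ;;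
  ISet 5 (cst 0) (IGet 5 (cst 1)).

Definition cluster_prog : cmd := depth_prog ;; descend_prog ;; search_prog.

End Program.

Ltac step := first [apply: wp_seq | apply: wp_iset | apply: wp_rset
  | apply: wp_pset | apply: wp_skip]; rewrite /=.

(** * The depth of the proxies *)

Section Verification.
Context {R : realType} {U : metricType R}.
Implicit Types (M : memory U) (n : nat).

Definition arr (f : int -> int) (s : seq int) : Prop :=
  forall i, (i < size s)%N -> f i%:Z = nth 0 s i.

(** The number of doublings is bounded by [j < 2^j < 4/e], linear rather than logarithmic in [1/e];
    the factor [1/e] of the time bound absorbs it. *)
Lemma depth_spec n M (eps : R) (E : nat) : rmem M 0 0 = eps -> 0 < eps ->
  1 / Num.min eps 1 <= E%:R -> (1000 * E + 100 <= n)%N ->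
  wp depth_prog n M (fun n' M' => (n - (1000 * E + 100) <= n')%N /\
    rmem M' 1 0 = Num.min eps 1 /\
    exists j : nat, [/\ imem M' 15 0 = j%:Z, 4 <= 2 ^+ j * Num.min eps 1 &
      2 ^+ j * Num.min eps 1 < 8]).
Proof.
move=> M0 eps0; set e := Num.min eps 1 => eE nE.
have e0 : 0 < e by rewrite /e lt_min eps0 ltr01.
have e1 : e <= 1 by rewrite /e ge_min lexx orbT.
step; apply: (wp_conseq _ _ _ (fun n' M' => (n - 20 <= n')%N /\ rmem M' 1 0 = e)).
  apply: wp_if => /=; [lia|move=> H|move=> H]; step; try lia.
    by split; [lia|rewrite update_same M0 /e; apply/esym/min_idPl; rewrite -M0].
  split; [lia|rewrite update_same /e; apply/esym/min_idPr].
  by rewrite M0 -ltNge in H; apply: ltW.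
move=> n1 M1 _ [n1n e1M]; step; step; first lia.
step; step; first lia.
pose I n' M' := exists j : nat, [/\ rmem M' 1 0 = e, imem M' 15 0 = j%:Z,
  rmem M' 2 0 = 2 ^+ j, 2 ^+ j * e < 8 & (30 * (8 * E - j) + 20 + (n - (1000 * E + 100)) <= n')%N].
apply: (wp_while _ _ I) => /=.
- exists 0%N; rewrite /= !update_same expr0 mul1r; split=> //.
    by apply: le_lt_trans e1 _; lra.
  lia.
- by move=> n' M' _ [j [_ _ _ _ ?]]; lia.
- move=> n' M' _ [j [H1 H2 H3 H4 H5]]; rewrite H1 H3 => H6.
  have jE : (j < 4 * E)%N.
    rewrite -(@ltr_nat R); have : (j%:R : R) < 2 ^+ j.
      by rewrite -natrX ltr_nat ltn_expl.
    have : (4 * E)%:R >= 4 / e :> R by rewrite natrM; move: eE; rewrite div1r; lra.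
    rewrite -ltNge in H6; have : 2 ^+ j < 4 / e by rewrite ltr_pdivlMr.
    lra.
  step; step; first lia.
  step; first lia.
  exists j.+1; rewrite /= !update_same H2 H3 -mulr2n -[_ *+ 2]mulr_natl -exprS.
  split=> //; [lia| |lia].
  by rewrite -ltNge in H6; rewrite exprS -mulrA; move: H6; lra.
- move=> n' M' _ [j [H1 H2 H3 H4 H5]]; rewrite negbK H1 H3 => H6.
  by split; [lia|split=> //; exists j].
Qed.

End Verification.

(** * Descent in the tree *)

Ltac ev := rewrite /= ?update_same /update /= ?eqxx /=.

Section Descent.
Context {R : realType} {U : metricType R}.
Implicit Types (M : memory U) (n : nat).

Lemma arr_append f a s v : arr (f a) s ->
  arr (update f a (size s)%:Z v a) (rcons s v).
Proof.
move=> fs i; rewrite size_rcons ltnS nth_rcons /update eqxx eqz_nat /= => iN.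
by case: ltngtP iN => // /fs.
Qed.

Lemma arr_replace f a s x t v : arr (f a) (s ++ x :: t) ->
  arr (update f a (size s)%:Z v a) (s ++ v :: t).
Proof.
move=> fs i; rewrite size_cat /= => iN.
have := fs i; rewrite size_cat /= => /(_ iN).
rewrite /update eqxx eqz_nat /= !nth_cat.
case: ltngtP => [//|si|->]; last by rewrite subnn.
by rewrite -(prednK (_ : 0 < i - size s)%N) ?subn_gt0.
Qed.

(** Same as [linked], but depending only on the array of sibling pointers, so that it survives
    writes elsewhere in memory. *)
Fixpoint chain (f : int -> int) (a : int) (s : seq int) : Prop :=
  if s is b :: s' then a = b /\ chain f (f b) s' else a = -1.

Lemma scan_spec n M (fs : seq int) :
  arr (imem M 6) fs -> imem M 10 0 = (size fs)%:Z -> imem M 13 0 = 0 ->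
  (size fs * 60 + 20 <= n)%N ->
  wp (for_loop 11 10 0 scan_body) n M (fun n' M' =>
    (n - (size fs * 60 + 20) <= n')%N /\
    ((imem M' 13 0 = 0 /\ forall a, a \in fs -> imem M 3 a < 0) \/
     (imem M' 13 0 = 1 /\ (exists2 a, a \in fs & 0 <= imem M 3 a /\
        imem M' 12 0 = imem M 0 (imem M 3 a)) /\
      forall a, a \in fs -> 0 <= imem M 3 a ->
        imem M 0 (imem M 3 a) <= imem M' 12 0))).
Proof.
move=> F cnt found nN.
pose I (i : nat) M' :=
  ((imem M' 13 0 = 0 /\ forall a, a \in take i fs -> imem M 3 a < 0) \/
     (imem M' 13 0 = 1 /\ (exists2 a, a \in take i fs & 0 <= imem M 3 a /\
        imem M' 12 0 = imem M 0 (imem M 3 a)) /\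
      forall a, a \in take i fs -> 0 <= imem M 3 a ->
        imem M 0 (imem M 3 a) <= imem M' 12 0)).
apply: (wp_for _ _ _ _ (size fs) 40 I) => //.
- lia.
- by left; rewrite take0.
- move=> i n' M' iN [fr _ _] iv Ii n'T.
  have F6 : imem M' 6 i%:Z = nth 0 fs i by rewrite fr // F.
  rewrite /scan_body; step; step; first lia.
  rewrite iv F6 (fr 3%N isT).
  set a := nth 0 fs i; set c := imem M 3 a.
  have tk : take i.+1 fs = rcons (take i fs) a by rewrite -take_nth.
  apply: wp_if => /=; first lia; ev; rewrite (fr 0%N isT).
  + move=> /andP[c0 nle].
    step; step; first lia.
    step; first lia.
    split; first lia.
    right; ev; split=> //; rewrite tk; split.
      exists a; first by rewrite mem_rcons mem_head.
      by rewrite (fr 0%N isT).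
    move=> b; rewrite mem_rcons inE (fr 0%N isT) => /predU1P[->//|bt] b0.
    case: Ii => [[_ /(_ _ bt)]|[f1 [_ /(_ _ bt b0)]]]; first by rewrite ltNge b0.
    by move=> lb; apply: (le_trans lb); move: nle; rewrite f1 /= -ltNge => /ltW.
  + move=> cond; step; first lia; split; first lia.
    rewrite /I /= tk; case: Ii => [[f0 H]|[f1 [[b bt b0] H]]]; [left|right].
      split=> // b; rewrite mem_rcons inE => /predU1P[->|/H//].
      by move: cond; rewrite f0 /= andbT -ltNge.
    split=> //; split; first by exists b => //; rewrite mem_rcons inE bt orbT.
    move=> d; rewrite mem_rcons inE => /predU1P[->|/H//] c0.
    by move: cond; rewrite f1 /= c0 /= negbK.
- move=> n' M' fr n'n _; rewrite /I take_size => H; split; first by lia.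
  by [].
Qed.

Lemma append_spec n M (xs : seq int) (fs : seq int) (p : U) (pos : nat) :
  imem M 11 0 = pos%:Z -> (pos < size fs)%N ->
  pmem M 0 (nth 0 fs pos) = p ->
  arr (imem M 6) fs -> imem M 10 0 = (size fs)%:Z ->
  chain (imem M 4) (imem M 16 0) xs -> {in xs, forall a, 0 <= a} ->
  (size xs * 40 + 10 <= n)%N ->
  wp append_prog n M (fun n' M' => (n - (size xs * 40 + 10) <= n')%N /\
    [/\ arr (imem M' 6) (fs ++ xs), imem M' 10 0 = (size (fs ++ xs))%:Z &
      (xs = [::] /\ rmem M' 3 0 = rmem M 3 0) \/
      exists2 b, b \in xs & rmem M' 3 0 = mdist p (pmem M 0 b)]).
Proof.
move=> iv iF pF F cnt ch xs0 nN.
pose I n' M' := exists d t, [/\ xs = d ++ t, arr (imem M' 6) (fs ++ d),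
  imem M' 10 0 = (size (fs ++ d))%:Z, chain (imem M 4) (imem M' 16 0) t &
  (size t * 40 + 10 + (n - (size xs * 40 + 10)) <= n')%N /\
  ((d = [::] /\ rmem M' 3 0 = rmem M 3 0) \/
      exists2 b, b \in d & rmem M' 3 0 = mdist p (pmem M 0 b))].
apply: (wp_while _ _ I) => /=.
- exists [::], xs; rewrite cats0; split=> //; split; [lia|by left].
- by move=> n' M' _ [d [t [_ _ _ _ [? _]]]]; lia.
- move=> n' M' [fi fr fp] [d [[|b t] [E F' cnt' ch' [bn _]]]] /=.
    by rewrite ch'.
  case: ch' => c16 ch' _; rewrite /= in bn.
  step; step; first lia.
  step; step; first lia.
  step; step; first lia.
  step; first lia.
  rewrite c16 cnt'.
  have iv' : imem M' 11 0 = pos%:Z by rewrite fi.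
  have p4 : imem M' 4 = imem M 4 by rewrite fi.
  have p0 : pmem M' 0 = pmem M 0 by rewrite fp.
  exists (rcons d b), t; rewrite -rcons_cat; split.
  + by rewrite cat_rcons.
  + exact: (arr_append (imem M') 6%N _ b F').
  + by ev; rewrite cnt' size_rcons; lia.
  + by ev; rewrite c16 p4.
  + split; first lia.
    right; exists b; first by rewrite mem_rcons mem_head.
    ev; rewrite p0 iv' c16 eqz_nat.
    have -> : (pos == size (fs ++ d)) = false by rewrite size_cat; lia.
    rewrite F'; last by rewrite size_cat; lia.
    by rewrite nth_cat iF pF.
- move=> n' M' _ [d [[|b t] [E F' cnt' ch' [bn dl]]]] /=; last first.
    case: ch' => -> _; have -> // : 0 <= b.
    by apply: xs0; rewrite E mem_cat mem_head orbT.
  move=> _; split; first by move: bn => /=; lia.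
  by rewrite cats0 in E; rewrite E.
Qed.

End Descent.

(** * Replacing nodes by their children *)

Section Expansion.
Context {R : realType} {U : metricType R}.
Implicit Types (M : memory U) (n : nat).

(** Each listed node is charged for [N] children, so a visited level costs O(N^2) steps. In the last
    clause, a list that grows always comes with a recorded sibling distance; this ensures that a
    scale is available once the list exceeds [k + z]. *)
Lemma expand_spec n M (addr : int * U -> int) (kids : int * U -> seq (int * U))
    (fr : seq (int * U)) (m : int) (N : nat) :
  arr (imem M 6) (map addr fr) -> imem M 10 0 = (size fr)%:Z ->
  imem M 17 0 = (size fr)%:Z -> imem M 12 0 = m ->
  (forall v, v \in fr -> uniq (kids v) /\
     chain (imem M 4) (imem M 3 (addr v)) (map addr (kids v))) ->
  (forall v w, v \in fr -> w \in kids v -> [/\ 0 <= addr w,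
     imem M 0 (addr w) = w.1, pmem M 0 (addr w) = w.2 & w.1 <= m]) ->
  (forall v, v \in fr -> size (new_kids kids m v) <= N)%N ->
  (size fr * (N * 40 + 80) + 20 <= n)%N ->
  wp (for_loop 11 17 0 expand_body) n M (fun n' M' =>
    (n - (size fr * (N * 40 + 80) + 20) <= n')%N /\
    exists fr', [/\ perm_eq fr' (flatten (map (new_kids kids m) fr)),
      arr (imem M' 6) (map addr fr'), imem M' 10 0 = (size fr')%:Z &
      (size fr' = size fr /\ rmem M' 3 0 = rmem M 3 0) \/
      exists v a b, [/\ v \in fr, a \in kids v, b \in kids v, a != b &
        a.1 = m /\ rmem M' 3 0 = mdist a.2 b.2]]).
Proof.
move=> F cnt n0 mE kch kP kN nN.
pose nk := new_kids kids m.
pose sib M' := exists v a b, [/\ v \in fr, a \in kids v, b \in kids v, a != b &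
        a.1 = m /\ rmem M' 3 0 = mdist a.2 b.2].
(* [X] holds what replaced the first [i] nodes in place, and [Y] the siblings appended so far. *)
pose I (i : nat) M' := exists X Y, [/\ size X = i,
  arr (imem M' 6) (map addr (X ++ drop i fr ++ Y)),
  imem M' 10 0 = (size (X ++ drop i fr ++ Y))%:Z,
  perm_eq (X ++ Y) (flatten (map nk (take i fr))) &
  (Y = [::] /\ rmem M' 3 0 = rmem M 3 0) \/ sib M'].
apply: (wp_for _ _ _ _ (size fr) (N * 40 + 60) I) => //.
- by move: nN; clear; rewrite !mulnDr; move: (size fr * (N * 40))%N; lia.
- by exists [::], [::]; rewrite drop0 /= !cats0 take0; split=> //; left.
- move=> i n' M' iN [fi ff fp] iv [X [Y [sX F' cnt' pe dl]]] n'T.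
  have v0 : int * U by case: (fr) iN => // v0.
  pose v := nth v0 fr i.
  have vfr : v \in fr by apply: mem_nth.
  have dr : drop i fr = v :: drop i.+1 fr by rewrite (drop_nth v0).
  have tk : take i.+1 fr = rcons (take i fr) v by rewrite (take_nth v0).
  have fl : flatten (map nk (take i.+1 fr)) = flatten (map nk (take i fr)) ++ nk v.
    by rewrite tk map_rcons -cats1 flatten_cat /= cats0.
  have iF : imem M' 6 i%:Z = addr v.
    rewrite F' ?size_map ?dr; last by rewrite size_cat /= sX; lia.
    by rewrite map_cat nth_cat size_map sX ltnn subnn.
  have keep n2 M2 : (n' - (N * 40 + 60) <= n2)%N -> imem M2 6 = imem M' 6 ->
      imem M2 10 = imem M' 10 -> rmem M2 3 = rmem M' 3 -> nk v = [:: v] ->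
      (n' - (N * 40 + 60) <= n2)%N /\ I i.+1 (put_int M2 11 0 i.+1%:Z).
    move=> bn e6 e10 e3 ev; split=> //; exists (rcons X v), Y.
    rewrite /= -[update _ _ _ _ 6]/(imem M2 6) -[update _ _ _ _ 10]/(imem M2 10).
    rewrite e6 e10 cat_rcons -[v :: _ ++ Y]/((v :: drop i.+1 fr) ++ Y) -dr.
    rewrite /sib /= e3 size_rcons sX; split=> //.
    apply/permP => P; move/permP/(_ P): pe.
    by rewrite fl ev cat_rcons !count_cat /= => <-; clear; lia.
  have [uk ch] := kch _ vfr.
  have f3 : imem M' 3 = imem M 3 by rewrite fi.
  have f0 : imem M' 0 = imem M 0 by rewrite fi.
  have f4 : imem M' 4 = imem M 4 by rewrite fi.
  have f12 : imem M' 12 = imem M 12 by rewrite fi.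
  have fp0 : pmem M' 0 = pmem M 0 by rewrite fp.
  rewrite /expand_body; step; step; first lia.
  rewrite iv iF f3.
  apply: wp_if => /=; first lia; ev; rewrite f0 f12 mE.
  + case E : (kids v) ch => [|w ks] /= ch; first by rewrite ch.
    case: ch => -> ch /andP[_ mw].
    have wv : w \in kids v by rewrite E mem_head.
    have [aw lw pw wm] := kP v w vfr wv; rewrite lw in mw.
    have {wm mw}wm : w.1 = m by apply/eqP; rewrite eq_le wm.
    have nkv : nk v = kids v by rewrite /nk /new_kids E wm eqxx.
    have ksN : (size ks <= N)%N.
      by have := kN _ vfr; rewrite -/nk nkv E /=; apply: ltnW.
    step; step; first lia.
    step; step; first lia.
    set M2 := put_int _ 16 0 _.
    pose fs := map addr (X ++ w :: drop i.+1 fr ++ Y).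
    have F2 : arr (imem M2 6) fs.
      have H : arr (update (imem M') 6 i%:Z (addr w) 6) fs.
        rewrite /fs map_cat /= -sX -(size_map addr X).
        apply: (arr_replace _ _ _ (addr v)); rewrite -map_cons -map_cat.
        by move: F'; rewrite dr size_map sX.
      by move=> i2 Hi; rewrite -(H i2 Hi) /M2; ev; rewrite iv.
    apply: (wp_conseq _ _ _ _ _ (append_spec _ M2 (map addr ks) fs w.2 i _ _ _ F2 _ _ _ _)).
    * by rewrite -iv.
    * by rewrite /fs size_map size_cat /= sX; clear; lia.
    * rewrite /fs map_cat nth_cat size_map sX ltnn subnn /=.
      by rewrite -[pmem _ _]/(pmem M' 0) fp0.
    * by rewrite -[imem M2 10]/(imem M' 10) cnt' dr /fs size_map !size_cat /= size_cat.
    * rewrite -[imem M2 4]/(imem M' 4) f4 /M2; ev.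
      by rewrite f4.
    * move=> a /mapP[u uk' ->]; have [] // := kP v u vfr.
      by rewrite E inE uk' orbT.
    * by rewrite size_map; lia.
    move=> n3 M3 [gi gr gp] [bn [F3 c3 d3]]; rewrite size_map in bn.
    split; first lia.
    exists (rcons X w), (Y ++ ks); split.
    * by rewrite size_rcons sX.
    * move: F3; rewrite /fs -map_cat; congr (arr _ (map _ _)).
      by rewrite cat_rcons -!catA /= !catA.
    * move: c3; rewrite /fs -map_cat size_map -[imem (put_int _ _ _ _) 10]/(imem M3 10) => ->.
      by rewrite cat_rcons -!catA /= -!catA.
    * apply/permP => P; move/permP/(_ P): pe.
      by rewrite fl nkv E cat_rcons !(count_cat, count_cat _ _ (_ :: _)) /= count_cat => <-; clear; lia.
    * case: d3 => [[ks0 d3]|[b' /mapP[b bks ->] d3]].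
        have k0 : ks = [::] by move: ks0; case: (ks).
        case: dl => [[Y0 d0]|[v' [a [b [? ? ? ? [? d0]]]]]]; [left|right].
          by split; [rewrite Y0 k0|rewrite -[rmem _ 3]/(rmem M3 3) d3].
        exists v', a, b; split=> //; split=> //.
        by rewrite -[rmem _ 3]/(rmem M3 3) d3.
      right; exists v, w, b; split=> //.
      - by rewrite E inE bks orbT.
      - by move: uk; rewrite E /= => /andP[+ _]; apply: contra => /eqP ->.
      - split=> //; rewrite -[rmem _ 3]/(rmem M3 3) d3.
        have bv : b \in kids v by rewrite E inE bks orbT.
        by have [_ _ e _] := kP v b vfr bv; rewrite -[pmem M2 0]/(pmem M' 0) fp0 e.
  + move=> cond; step; first lia; apply: keep => //; first by lia.
    rewrite /nk /new_kids; case E : (kids v) ch cond => [//|w ks] /= [-> _].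
    have wv : w \in kids v by rewrite E mem_head.
    have [-> -> _ _] := kP v w vfr wv => /=.
    by case: eqP => // ->; rewrite lexx.
- move=> n' M' _ n'n _ [X [Y [sX F' cnt' pe dl]]]; split.
    by move: n'n; clear; rewrite !mulnDr; move: (size fr * (N * 40))%N; lia.
  exists (X ++ Y); move: F' cnt' pe; rewrite drop_size take_size => F' cnt' pe.
  split=> //; case: dl => [[Y0 d]|]; [left|by right].
  by rewrite Y0 cats0.
Qed.

End Expansion.

(** * The loop over visited levels *)

Section DescentLoop.
Context {R : realType} {U : metricType R}.
Variables (S : {fset U}) (T : ctree U).
Hypothesis HT : cover_tree S T.
Implicit Types (M : memory U) (n : nat).

(* i counts the levels visited before level m. *)
Lemma level_count_lt (m : int) (i Lv : nat) (dx dn : R) :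
  2 ^ (m - 1 + i%:Z) < dx -> dn <= 2 ^ (m + 1) -> 0 < dn ->
  4 * (dx / dn) <= 2 ^+ Lv -> (i < Lv)%N.
Proof.
move=> h1 h2 d0 h3; rewrite -(@ltr_eXn2l R 2) ?ltr1n //.
apply: lt_le_trans h3; rewrite mulrA ltr_pdivlMr //.
have E : (2 : R) ^ (m - 1 + i%:Z) = 2 ^ (m - 1) * 2 ^+ i by rewrite expfzDr.
have E2 : (2 : R) ^ (m + 1) = 4 * 2 ^ (m - 1).
  have -> : m + 1 = m - 1 + 2%:Z by clear; lia.
  by rewrite expfzDr // mulrC -exprnP -natrX.
apply: (@le_lt_trans _ _ (2 ^+ i * 2 ^ (m + 1))).
  by rewrite ler_wpM2l // exprn_ge0.
by rewrite E2 mulrCA ltr_pM2l // mulrC -E.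
Qed.

(** The content of [stores_tree], with the lists of children, existential there, fixed by a function
    [kids]. *)
Definition stored (addr : int * U -> int) (kids : int * U -> seq (int * U)) M :=
  forall v, explicit_node T v.1 v.2 ->
    [/\ 0 <= addr v, imem M 0 (addr v) = v.1,
        imem M 1 (addr v) = (weight S T v.1 v.2)%:Z & pmem M 0 (addr v) = v.2] /\
    [/\ uniq (kids v),
        forall l q, (l, q) \in kids v <-> explicit_child T v.1 v.2 l q &
        chain (imem M 4) (imem M 3 (addr v)) (map addr (kids v))].

Lemma sibling_dist m (v a b : int * U) :
  explicit_child T v.1 v.2 a.1 a.2 -> explicit_child T v.1 v.2 b.1 b.2 ->
  a != b -> a.1 = m -> m < root_level T ->
  [/\ a.2 \in S, b.2 \in S, a.2 != b.2 & mdist a.2 b.2 <= 4 * 2 ^ m].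
Proof.
move=> ea eb ab am mr; have bm := explicit_child_level _ _ _ _ _ _ eb ea.
have [[na _] _ pa _] := ea; have [[nb _] _ pb _] := eb.
rewrite bm am in na nb pa pb.
split; [exact: node_in_set HT _ _ na|exact: node_in_set HT _ _ nb| |].
  by apply: contra ab => /eqP e; rewrite -pair_eqE /= bm e !eqxx.
apply: le_trans (metric_triangle _ v.2 _) _.
have := ct_covering HT mr na; have := ct_covering HT mr nb.
by rewrite pa pb (metric_sym v.2) pow2S; lra.
Qed.

Lemma descend_spec n M addr kids (k z j N Lv : nat) (l : int) :
  stored addr kids M ->
  (forall p, node T (root_level T) p -> imem M 5 0 = addr (root_level T, p)) ->
  imem M 5 1 = k%:Z -> imem M 5 2 = z%:Z -> imem M 15 0 = j%:Z ->
  (0 < k)%N ->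
  (#|` pts T (l + 1)| <= k + z)%N -> (k + z < #|` pts T l|)%N ->
  N = #|` pts T (l - j%:Z)| ->
  4 * aspect_ratio S <= 2 ^+ Lv ->
  ((Lv + 1) * (N * (N * 40 + 200) + 200) + 50 <= n)%N ->
  wp descend_prog n M (fun n' M' =>
    (n - ((Lv + 1) * (N * (N * 40 + 200) + 200) + 50) <= n')%N /\
    exists fr, [/\ frontier T (l - j%:Z) fr, arr (imem M' 6) (map addr fr),
      imem M' 10 0 = N%:Z, size fr = N &
      exists a b, [/\ a \in S, b \in S, a != b, rmem M' 3 0 = mdist a b &
        mdist a b <= 4 * 2 ^ l]]).
Proof.
move=> st rt Ek Ez Ej k0 cl1 cl NE LvE nN.
set W := (N * (N * 40 + 200) + 200)%N in nN *.
set rest := (n - _)%N.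
have WE : W = (N * (N * 40 + 200) + 200)%N by [].
have restE : rest = (n - ((Lv + 1) * W + 50))%N by [].
clearbody rest W.
have sizeN L fr : frontier T L fr -> l - j%:Z <= L -> (size fr <= N)%N.
  move=> F Ll; rewrite (frontier_size _ _ _ F) NE.
  exact: card_nested HT _ _ Ll.
have [p0 p0r] : exists p, node T (root_level T) p.
  by have /eqP/cardfs1P[x E] := ct_root HT; exists x; rewrite /node E inE.
have lr : l < root_level T.
  rewrite ltNge; apply/negP => rl.
  by have := card_nested _ _ HT _ _ rl; rewrite (ct_root HT); move: cl k0; clear; lia.
rewrite /descend_prog.
step; step; first lia.
step; step; first lia.
step; step; first lia.
pose good M' := exists a b, [/\ a \in S, b \in S, a != b, rmem M' 3 0 = mdist a b &
        mdist a b <= 4 * 2 ^ l].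
(* After [i] visits the first visited level was at least [L + i - 1], and the pair found there is
   more than [2^(L + i - 2)] apart. Target and recorded distance are meaningful only once the list
   has more than [k + z] nodes. *)
pose J n' M' := exists L fr (i : nat),
  [/\ frontier T L fr, arr (imem M' 6) (map addr fr),
      imem M' 10 0 = (size fr)%:Z, l - j%:Z <= L &
   [/\ (k + z < size fr)%N -> imem M' 14 0 = l - j%:Z /\ good M',
       i = 0%N \/ 2 ^ (L + i%:Z - 2) < dmax S,
       imem M' 13 0 = 1 /\ (i <= Lv)%N \/ imem M' 13 0 = 0 /\
         (k + z < size fr)%N /\ frontier T (l - j%:Z) fr,
       (0 < size fr)%N &
       ((if imem M' 13 0 == 1 then (Lv + 1 - i) * W else 0) + 20 + rest <= n')%N]].
apply: (wp_while _ _ J) => /=.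
- exists (root_level T), [:: (root_level T, p0)], 0%N; split=> //.
  + exact: (frontier_root _ _ HT _ p0r).
  + by move=> [|//] _; ev; rewrite (rt _ p0r).
  + by move: lr; clear; lia.
  + split=> //; [by move=> H; exfalso; move: H k0; clear; rewrite /=; lia|by left|by left; split|].
    ev; rewrite subn0 restE; move: nN; clear.
    by move: ((Lv + 1) * W)%N; lia.
- by move=> n' M' _ [L [fr [i [_ _ _ _ [_ _ _ _]]]]]; clear; move: (if _ then _ else _)%N => ?; lia.
- move=> n' M' [fi fr_ fp] [L [fr [i [F F6 c10 lL [tg iL fo s0 bn]]]]] f1.
  have {fo} [f13 iLv] : imem M' 13 0 = 1 /\ (i <= Lv)%N.
    by case: fo => // -[f0 _]; rewrite f0 in f1.
  rewrite f13 eqxx in bn.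
  have [X XE] : exists X, X = ((Lv - i) * W)%N by eexists.
  have [ce ceE] : exists ce, ce = (size fr * (N * 40 + 80) + 20)%N by eexists.
  have {}bn : (W + (X + 20 + rest) <= n')%N.
    rewrite XE; move: bn; have -> : (Lv + 1 - i = (Lv - i).+1)%N by move: iLv; clear; lia.
    by rewrite mulSn; clear; move: (_ * W)%N; lia.
  have sN := sizeN _ _ F lL.
  have W0 : (size fr * 60 + 20 + ce + 100 <= W)%N.
    rewrite ceE.
    have : (size fr * (N * 40 + 200) <= N * (N * 40 + 200))%N by rewrite leq_mul2r sN orbT.
    by rewrite WE !mulnDr; clear; move: (_ * (N * 40))%N (_ * (N * 40))%N; lia.
  have f0 : imem M' 0 = imem M 0 by rewrite fi.
  have f3 : imem M' 3 = imem M 3 by rewrite fi.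
  have f4 : imem M' 4 = imem M 4 by rewrite fi.
  have f5 : imem M' 5 = imem M 5 by rewrite fi.
  have f15 : imem M' 15 = imem M 15 by rewrite fi.
  have fp0 : pmem M' 0 = pmem M 0 by rewrite fp.
  have exn v : v \in fr -> explicit_node T v.1 v.2.
    by case: F => _ _ /(_ v) fP /fP[].
  have kidE v w : v \in fr -> w \in kids v -> explicit_child T v.1 v.2 w.1 w.2.
    by move=> /exn/st[_ [_ kv _]] wk; apply/kv; rewrite -surjective_pairing.
  have kidA v w : v \in fr -> w \in kids v ->
      [/\ 0 <= addr w, imem M 0 (addr w) = w.1 & pmem M 0 (addr w) = w.2].
    by move=> vfr /(kidE _ _ vfr)[/st[[? ? ? ?] _] _ _ _].
  rewrite /descend_body; step; step; first by move: bn W0; clear; lia.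
  step.
  apply: (wp_conseq _ _ _ _ _ (scan_spec _ (put_int M' 13 0 0) (map addr fr) _ _ _ _)) => //.
  + by rewrite size_map.
  + by rewrite size_map; move: bn W0; clear; lia.
  move=> n1 M1 [gi gr gp]; rewrite size_map => -[bn1 sc].
  have g10 : imem M1 10 0 = (size fr)%:Z by rewrite gi.
  have g14 : imem M1 14 = imem M' 14 by rewrite gi.
  have g5 : imem M1 5 = imem M 5 by rewrite gi // -f5.
  have g15 : imem M1 15 = imem M 15 by rewrite gi // -f15.
  have g6 : imem M1 6 = imem M' 6 by rewrite gi.
  have g3 : rmem M1 3 = rmem M' 3 by rewrite gr.
  have e3 : imem (put_int M' 13 0 0) 3 = imem M 3 by rewrite -f3.
  have e0 : imem (put_int M' 13 0 0) 0 = imem M 0 by rewrite -f0.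
  rewrite e3 e0 in sc.
  have down L' : L' <= L ->
      (forall v w, v \in fr -> w \in kids v -> w.1 < L') -> frontier T L' fr.
    move=> LL nk; apply: (frontier_down _ _ HT _ _ _ F LL) => // v m q vfr ec.
    have [_ [_ kv _]] := st v (exn v vfr).
    by apply: (nk v (m, q) vfr); apply/kv.
  case: sc => [[s13 nok]|[s13 [[_ /mapP[v vfr ->] [c0 s12]] smax]]].
    have nk v : v \in fr -> kids v = [::].
      move=> vfr; have [_ [_ _ ch]] := st v (exn v vfr).
      have := nok _ (map_f addr vfr); case E : (kids v) ch => [//|w ks] /= [-> _].
      by have [] := kidA v w vfr _; rewrite ?E ?mem_head // => w0 _ _; rewrite ltNge w0.
    have down0 L' : L' <= L -> frontier T L' fr.
      by move=> LL; apply: down => // v w vfr; rewrite nk.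
    (* A list without children names every lower level too, in particular one at or below [l]. *)
    have big : (k + z < size fr)%N.
      have Fm := down0 (Num.min L l) _; rewrite (frontier_size _ _ _ (Fm _)) ?ge_min ?lexx //.
      by apply: leq_trans cl _; apply: (card_nested _ _ HT); rewrite ge_min lexx orbT.
    step; apply: (wp_conseq _ _ _ (fun n2 M2 => (n1 - 20 <= n2)%N /\ M2 = M1)).
      apply: wp_if => /=; first by move: bn bn1 W0; clear; lia.
        by rewrite g10 g5 Ek Ez; move: big; clear; lia.
      by move=> _; step; [|split=> //]; move: bn bn1 W0; clear; lia.
    move=> n2 M2 _ [bn2 ->].
    apply: wp_if => /=; first by move: bn bn1 bn2 W0; clear; lia.
      by rewrite s13.
    move=> _; step; first by move: bn bn1 bn2 W0; clear; lia.
    exists L, fr, i; split=> //; rewrite -?[imem _ 6]/(imem M1 6) ?g6 //.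
    split=> //.
    - by move=> _; rewrite -[imem _ 14]/(imem M1 14) g14 /good /= g3; apply: tg.
    - by right; ev; split=> //; split=> //; apply: down0.
    - by ev; move: bn bn1 bn2 W0; clear; lia.
  set m := imem M1 12 0 in s12 smax.
  have [w [ks kv]] : exists w ks, kids v = w :: ks.
    have [_ [_ _ ch]] := st v (exn v vfr).
    case E : (kids v) ch => [|w ks] /= ch; last by exists w, ks.
    by rewrite ch in c0.
  have wv : w \in kids v by rewrite kv mem_head.
  have wm : w.1 = m.
    have [_ [_ _ ch]] := st v (exn v vfr); move: ch; rewrite kv /= => -[cw _].
    by have [_ lw _] := kidA v w vfr wv; rewrite s12 cw lw.
  have ew := kidE v w vfr wv.
  have mL : m < L by rewrite -wm; apply: (frontier_child_lt _ _ _ _ _ _ F vfr ew).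
  have mr : m < root_level T.
    by apply: lt_le_trans mL _; apply: (frontier_le_root _ _ HT _ _ F).
  have kle v' w' : v' \in fr -> w' \in kids v' -> w'.1 <= m.
    move=> vfr' wk'; have [_ [_ _ ch]] := st v' (exn v' vfr').
    case E : (kids v') ch (wk') => [//|u us] /= [cu _] _.
    have uv : u \in kids v' by rewrite E mem_head.
    have [u0 lu _] := kidA v' u vfr' uv.
    have := smax _ (map_f addr vfr'); rewrite cu lu => /(_ u0).
    by rewrite (explicit_child_level _ _ _ _ _ _ (kidE _ _ vfr' wk') (kidE _ _ vfr' uv)).
  have F1 : frontier T (m + 1) fr.
    by apply: down => [|v' w' vfr' /(kle _ _ vfr')]; rewrite ?lezD1 // ltzD1.
  have sF1 := frontier_size _ _ _ F1.
  step; apply: (wp_conseq _ _ _ (fun n2 M2 => (n1 - 30 <= n2)%N /\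
    exists t, M2 = put_int M1 14 0 t /\
      t = if (size fr <= k + z)%N then m - j%:Z else l - j%:Z)).
    apply: wp_if => /=; first by move: bn bn1 W0; clear; lia.
      rewrite g10 g5 Ek Ez => le; step; first by move: bn bn1 W0; clear; lia.
      split; first by move: bn bn1 W0; clear; lia.
      exists (m - j%:Z); rewrite /m g15 Ej; split=> //.
      by case: leqP => //; move: le; clear; lia.
    rewrite g10 g5 Ek Ez => le; step; first by move: bn bn1 W0; clear; lia.
    split; first by move: bn bn1 W0; clear; lia.
    have big : (k + z < size fr)%N by move: le; clear; lia.
    exists (l - j%:Z); rewrite leqNgt big; split=> //.
    (* Skipping the assignment amounts to storing the current value of variable 14 again. *)
    have [t14 _] := tg big; rewrite -t14 -g14; clear.
    case: M1 => im rm pm; rewrite /put_int /=; congr Memory.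
    apply/funext => a; apply/funext => b; rewrite /update.
    by case: andP => // -[/eqP -> /eqP ->].
  move=> n2 M2 _ [bn2 [t [-> tE]]].
  apply: wp_if => /=; first by move: bn bn1 bn2 W0; clear; lia.
    ev; rewrite s13 /= -/m => tm.
    step; step; first by move: bn bn1 bn2 W0; clear; lia.
    set M3 := put_int (put_int M1 14 0 t) 17 0 _.
    have lm : l - j%:Z <= m.
      move: tm; rewrite tE; case: leqP => // sk _.
      have : l <= m.
        rewrite leNgt; apply/negP => ml; move: sk; rewrite sF1 leqNgt => /negP; apply.
        by apply: leq_trans cl _; apply: (card_nested _ _ HT); rewrite lezD1.
      by clear; lia.
    have F2 : frontier T m (flatten (map (new_kids kids m) fr)).
      apply: (frontier_expand _ _ HT _ _ _ F1) => // u ufr.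
      by have [_ [? ? _]] := st u (exn u ufr).
    have i6 : imem M3 6 = imem M' 6 by rewrite -g6.
    have i4 : imem M3 4 = imem M 4 by rewrite -f4 -[RHS]/(imem (put_int M' 13 0 0) 4) -gi.
    have i3 : imem M3 3 = imem M 3 by rewrite -f3 -[RHS]/(imem (put_int M' 13 0 0) 3) -gi.
    have i0 : imem M3 0 = imem M 0 by rewrite -f0 -[RHS]/(imem (put_int M' 13 0 0) 0) -gi.
    have ip : pmem M3 0 = pmem M 0 by rewrite -fp0 -[RHS]/(pmem (put_int M' 13 0 0) 0) -gp.
    apply: (wp_conseq _ _ _ _ _ (expand_spec _ M3 addr kids fr m N _ _ _ _ _ _ _ _)).
    - by rewrite i6.
    - by rewrite -g10.
    - by rewrite -g10 /M3; ev.
    - by [].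
    - by move=> u ufr; rewrite i4 i3; have [_ [? _ ?]] := st u (exn u ufr).
    - move=> u x ufr xu; have [? ? ?] := kidA u x ufr xu.
      by rewrite i0 ip; split=> //; apply: kle xu.
    - move=> u ufr; apply: leq_trans (sizeN _ _ F2 lm).
      elim: (fr) ufr => //= y s IH; rewrite inE size_cat => /predU1P[->|/IH H].
        exact: leq_addr.
      exact: leq_trans H (leq_addl _ _).
    - by rewrite -ceE; move: bn bn1 bn2 W0; clear; lia.
    move=> n4 M4 [hi hr hp]; rewrite -ceE => -[bn4 [fr' [pe F6' c10' dl]]].
    have F' : frontier T m fr' by apply: frontier_perm F2; rewrite perm_sym.
    have sF' := frontier_size _ _ _ F'.
    have h13 : imem M4 13 0 = 1 by rewrite hi // -s13.
    have h14 : imem M4 14 0 = t by rewrite hi // /M3; ev.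
    have h3 : rmem M3 3 = rmem M' 3 by rewrite -g3.
    (* The explicit child [w] on level [m] provides the pair of points that pays for this visit. *)
    have [a [b [aS bS ab /andP[dab1 dab2]]]] : exists a b, [/\ a \in S, b \in S, a != b &
        2 ^ (m - 1) < mdist a b <= 2 ^ (m + 1)].
      by case: ew; rewrite wm => ew _ _ _; apply: (explicit_level_pair _ _ HT _ _ mr ew).
    have ip1 : 2 ^ (m + i.+1%:Z - 2) < dmax S.
      case: iL => [->|]; last first.
        by apply: le_lt_trans; apply: pow2_mono; move: mL; clear; lia.
      have -> : m + 1%:Z - 2 = m - 1 by clear; lia.
      exact: lt_le_trans dab1 (le_dmax _ _ _ aS bS).
    have iLv1 : (i < Lv)%N.
      apply: (level_count_lt m i Lv (dmax S) (dmin S)) LvE.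
      - by have -> : m - 1 + i%:Z = m + i.+1%:Z - 2 by clear; lia.
      - exact: le_trans (dmin_le _ _ _ aS bS ab) dab2.
      - exact: dmin_gt0 aS bS ab.
    have szge : (size fr <= size fr')%N.
      by rewrite sF1 sF'; apply: (card_nested _ _ HT); rewrite lerDl.
    exists m, fr', i.+1; split=> //.
    split=> //.
    - move=> big; have ml : m <= l.
        rewrite leNgt; apply/negP => lm'; move: big; rewrite sF' ltnNge => /negP; apply.
        by apply: leq_trans cl1; apply: (card_nested _ _ HT); rewrite lezD1.
      have sg : (exists v a b, [/\ v \in fr, a \in kids v, b \in kids v, a != b &
        a.1 = m /\ rmem M4 3 0 = mdist a.2 b.2]) -> good M4.
        move=> [u [x [y [ufr xk yk xy [xm dxy]]]]].
        have [? ? ? le] := sibling_dist m u x y (kidE _ _ ufr xk) (kidE _ _ ufr yk) xy xm mr.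
        exists x.2, y.2; split=> //; apply: le_trans le _.
        by rewrite ler_pM2l // pow2_mono.
      (* If the list outgrows [k + z] at this very visit, then [m = l], and the growth means that
         siblings were appended. Otherwise target and distance were already right, and a new sibling
         pair at level at most [l] is as good as the old one. *)
      case: (leqP (size fr) (k + z)) => sk.
        have lem : l <= m.
          rewrite leNgt; apply/negP => ml'; move: sk; rewrite sF1 leqNgt => /negP; apply.
          by apply: leq_trans cl _; apply: (card_nested _ _ HT); rewrite lezD1.
        have -> : l = m by apply/eqP; rewrite eq_le lem ml.
        have lmE : l = m by apply/eqP; rewrite eq_le lem ml.
        split; first by rewrite h14 tE sk.
        case: dl => [[sz _]|/sg//].
        by move: big; rewrite sz ltnNge sk.
      have [_ gd] := tg sk; split; first by rewrite h14 tE leqNgt sk.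
      by case: dl => [[_ dE]|/sg//]; move: gd; rewrite /good dE h3.
    - by right.
    - by left.
    - exact: leq_trans s0 szge.
    - rewrite h13 eqxx; move: bn bn1 bn2 bn4 W0.
      have -> : (Lv + 1 - i.+1 = Lv - i)%N by clear; lia.
      rewrite -XE.
      by clear; lia.
  ev; rewrite s13 /= -/m -ltNge => tm.
  step; first by move: bn bn1 bn2 W0; clear; lia.
  (* For a short list the target [m - j] is never above [m], so the descent can stop only once there
     are more than [k + z] nodes. *)
  have sk : (k + z < size fr)%N.
    rewrite ltnNge; apply/negP => sk; move: tm; rewrite tE sk; clear; lia.
  have tE' : t = l - j%:Z by rewrite tE leqNgt sk.
  have [_ gd] := tg sk.
  exists L, fr, i; split=> //; rewrite -?[imem _ 6]/(imem M1 6) ?g6 //.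
  split=> //.
  + by move=> _; ev; split=> //; move: gd; rewrite /good /= g3.
  + right; ev; split=> //; split=> //.
    apply: down => // v' w' vfr' /(kle _ _ vfr') le.
    by apply: le_lt_trans le _; rewrite -tE'.
  + by ev; move: bn bn1 bn2 W0; clear; lia.
- move=> n' M' [fi fr_ fp] [L [fr [i [F F6 c10 lL [tg iL fo s0 bn]]]]] f1.
  case: fo => [[f13 _]|[f13 [sk Fj]]]; first by rewrite f13 in f1.
  split; first by move: bn; rewrite f13 /=; clear; lia.
  have [_ gd] := tg sk; have sz := frontier_size _ _ _ Fj.
  by exists fr; rewrite NE -sz; split.
Qed.

End DescentLoop.

(** * Greedy clustering *)

Section Search.
Context {R : realType} {U : metricType R}.
Variables (N : nat) (q : nat -> U) (w : nat -> nat).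
Implicit Types (M : memory U) (n : nat) (f : int -> int) (rho : R).

Definition proxies M : Prop := imem M 10 0 = N%:Z /\
  forall i, (i < N)%N -> pmem M 0 (imem M 6 i%:Z) = q i /\
    imem M 1 (imem M 6 i%:Z) = (w i)%:Z.

Definition ball_weight rho f (i : nat) : int :=
  \sum_(0 <= j < N) (if mdist (q i) (q j) <= rho then f j%:Z else 0).

Lemma proxies_eq M M' : imem M' 10 = imem M 10 -> imem M' 6 = imem M 6 ->
  imem M' 1 = imem M 1 -> pmem M' 0 = pmem M 0 -> proxies M -> proxies M'.
Proof. by rewrite /proxies => -> -> -> ->. Qed.

Lemma ball_spec n M (i : nat) rho : proxies M -> (i < N)%N ->
  imem M 11 0 = i%:Z -> rmem M 5 0 = rho -> imem M 8 i%:Z = 0 ->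
  (N * 50 + 20 <= n)%N ->
  wp (for_loop 20 10 0 ball_body) n M (fun n' M' =>
    (n - (N * 50 + 20) <= n')%N /\
    (forall a, a != i%:Z -> imem M' 8 a = imem M 8 a) /\
    imem M' 8 i%:Z = \sum_(0 <= j < N)
      (if mdist (q i) (q j) <= rho then (w j)%:Z else 0)).
Proof.
move=> [cN px] iN iv rhoE z8 nN.
pose I (y : nat) M' := (forall a, a != i%:Z -> imem M' 8 a = imem M 8 a) /\
    imem M' 8 i%:Z = \sum_(0 <= j < y)
      (if mdist (q i) (q j) <= rho then (w j)%:Z else 0).
apply: (wp_for _ _ _ _ N 30 I) => //.
- lia.
- by split=> //; rewrite big_geq.
- move=> y n' M' yN [fi fr fp] yv [Io Ii] n'T.
  have f11 : imem M' 11 0 = i%:Z by rewrite fi.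
  have f6 : imem M' 6 = imem M 6 by rewrite fi.
  have f1 : imem M' 1 = imem M 1 by rewrite fi.
  have fp0 : pmem M' 0 = pmem M 0 by rewrite fp.
  have f5 : rmem M' 5 0 = rho by rewrite fr.
  have [qi _] := px i iN; have [qy wy] := px y yN.
  rewrite /ball_body; apply: wp_if => /=; first lia.
    rewrite f11 yv f6 fp0 qi qy f5 => d.
    step; first lia.
    rewrite f11 yv Ii f6 f1 wy; split; first lia.
    split=> [a ai|]; ev; first by rewrite (negbTE ai) Io.
    by rewrite big_nat_recr //= d.
  rewrite f11 yv f6 fp0 qi qy f5 => d.
  step; first lia; split; first lia.
  by split=> //; rewrite big_nat_recr //= (negbTE d) addr0.
- by move=> n' M' _ n'n _ H; split=> //; lia.
Qed.

Lemma weigh_spec n M rho : proxies M -> rmem M 5 0 = rho -> imem M 21 0 = 0 ->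
  (N * (N * 50 + 80) + 20 <= n)%N ->
  wp (for_loop 11 10 0 weigh_body) n M (fun n' M' =>
    (n - (N * (N * 50 + 80) + 20) <= n')%N /\
    [/\ forall j, (j < N)%N -> imem M' 7 j%:Z = (w j)%:Z,
        forall i, (i < N)%N -> imem M' 8 i%:Z = \sum_(0 <= j < N)
          (if mdist (q i) (q j) <= rho then (w j)%:Z else 0) &
        imem M' 21 0 = \sum_(0 <= j < N) (w j)%:Z]).
Proof.
move=> px rhoE z21 nN; have [cN pxi] := px.
pose I (i : nat) M' :=
  [/\ forall j, (j < i)%N -> imem M' 7 j%:Z = (w j)%:Z,
        forall i', (i' < i)%N -> imem M' 8 i'%:Z = \sum_(0 <= j < N)
          (if mdist (q i') (q j) <= rho then (w j)%:Z else 0) &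
        imem M' 21 0 = \sum_(0 <= j < i) (w j)%:Z].
apply: (wp_for _ _ _ _ N (N * 50 + 60) I) => //.
- by move: nN; clear; rewrite !mulnDr; move: (N * (N * 50))%N; lia.
- by split=> //; rewrite big_geq.
- move=> i n' M' iN [fi fr fp] iv [I7 I8 I21] n'T.
  have [qi wi] := pxi i iN.
  have px' : proxies M' by apply: proxies_eq px; rewrite ?fi ?fp.
  have wi' : imem M' 1 (imem M' 6 i%:Z) = (w i)%:Z by rewrite !fi.
  rewrite /weigh_body; step; step; first lia.
  step; step; first lia.
  step; step; first lia.
  set M2 := put_int _ 21 0 _.
  apply: (wp_conseq _ _ _ _ _ (ball_spec _ M2 i rho _ iN _ _ _ _)).
  + exact: px'.
  + exact: iv.
  + by rewrite -rhoE -(fr 5%N).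
  + by rewrite /M2; ev; rewrite iv eqxx.
  + by lia.
  move=> n3 M3 [gi gr gp] [bn [Ho Hi]]; split; first lia.
  have g7 : imem M3 7 = imem M2 7 by rewrite gi.
  have g21 : imem M3 21 = imem M2 21 by rewrite gi.
  split=> [j|i'|].
  + rewrite ltnS leq_eqVlt -[imem _ 7]/(imem M3 7) g7 /M2; ev.
    rewrite iv eqz_nat => /predU1P[->|ji]; first by rewrite eqxx wi'.
    by rewrite ltn_eqF // I7.
  + rewrite ltnS leq_eqVlt -[imem _ 8]/(imem M3 8) => /predU1P[->//|ii].
    by rewrite Ho ?eqz_nat ?ltn_eqF // /M2; ev; rewrite iv eqz_nat ltn_eqF // I8.
  + rewrite -[imem _ 21]/(imem M3 21) g21 /M2; ev.
    by rewrite iv wi' I21 big_nat_recr.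
- move=> n' M' _ n'n _ H; split=> //.
  by move: n'n; clear; rewrite !mulnDr; move: (N * (N * 50))%N; lia.
Qed.

Lemma heaviest_spec n M : (0 < N)%N -> imem M 10 0 = N%:Z -> imem M 18 0 = 0 ->
  (N * 50 + 20 <= n)%N ->
  wp (for_loop 11 10 0 pick_body) n M (fun n' M' =>
    (n - (N * 50 + 20) <= n')%N /\ exists b : nat, [/\ (b < N)%N,
      imem M' 18 0 = b%:Z &
      forall i, (i < N)%N -> imem M 8 i%:Z <= imem M 8 b%:Z]).
Proof.
move=> N0 cN b0 nN.
pose I (i : nat) M' := exists b : nat, [/\ (b < N)%N, imem M' 18 0 = b%:Z &
      forall i', (i' < i)%N -> imem M 8 i'%:Z <= imem M 8 b%:Z].
apply: (wp_for _ _ _ _ N 30 I) => //.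
- lia.
- by exists 0%N.
- move=> i n' M' iN [fi fr fp] iv [b [bN bE bmax]] n'T.
  have f8 : imem M' 8 = imem M 8 by rewrite fi.
  rewrite /pick_body; apply: wp_if => /=; first lia.
    rewrite iv bE f8 => bi; step; first lia; split; first lia.
    exists i; split=> //.
    move=> i'; rewrite ltnS leq_eqVlt => /predU1P[->//|/bmax le].
    exact: le_trans le bi.
  rewrite iv bE f8 -ltNge => bi; step; first lia; split; first lia.
  exists b; split=> // i'; rewrite ltnS leq_eqVlt => /predU1P[->|/bmax//].
  exact: ltW.
- by move=> n' M' _ n'n _ H; split=> //; lia.
Qed.

Lemma discount_spec n M (y : nat) rho : proxies M -> (y < N)%N ->
  imem M 20 0 = y%:Z -> rmem M 5 0 = rho -> (N * 50 + 20 <= n)%N ->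
  wp (for_loop 11 10 0 discount_body) n M (fun n' M' =>
    (n - (N * 50 + 20) <= n')%N /\ forall i, (i < N)%N ->
      imem M' 8 i%:Z = imem M 8 i%:Z -
        (if mdist (q i) (q y) <= rho then imem M 7 y%:Z else 0)).
Proof.
move=> [cN px] yN yv rhoE nN.
pose I (i : nat) M' := forall i', (i' < N)%N ->
  imem M' 8 i'%:Z = imem M 8 i'%:Z - (if (i' < i)%N then
        (if mdist (q i') (q y) <= rho then imem M 7 y%:Z else 0) else 0).
apply: (wp_for _ _ _ _ N 30 I) => //.
- lia.
- by move=> i' _; rewrite ltn0 subr0.
- move=> i n' M' iN [fi fr fp] iv Ii n'T.
  have f20 : imem M' 20 0 = y%:Z by rewrite fi.
  have f6 : imem M' 6 = imem M 6 by rewrite fi.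
  have fp0 : pmem M' 0 = pmem M 0 by rewrite fp.
  have f5 : rmem M' 5 0 = rho by rewrite fr.
  have f7 : imem M' 7 = imem M 7 by rewrite fi.
  have [qi _] := px i iN; have [qy wy] := px y yN.
  have H8 := Ii i iN; rewrite ltnn subr0 in H8.
  rewrite /discount_body; apply: wp_if => /=; first lia.
    rewrite f20 iv f6 fp0 qi qy f5 => d.
    step; first lia.
    rewrite f20 iv H8 f7; split; first lia.
    move=> i' i'N; ev; rewrite eqz_nat ltnS leq_eqVlt.
    case: eqVneq => [->|ne] /=; first by rewrite d.
    exact: Ii.
  rewrite f20 iv f6 fp0 qi qy f5 => d.
  step; first lia; split; first lia.
  move=> i' i'N; rewrite ltnS leq_eqVlt.
  case: eqVneq => [->|ne] /=; first by rewrite (negbTE d) subr0 -H8.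
  exact: Ii.
- move=> n' M' _ n'n _ H; split; first lia.
  by move=> i iN; rewrite H // iN.
Qed.

Definition balanced rho M : Prop :=
  (forall i, (i < N)%N -> imem M 8 i%:Z = ball_weight rho (imem M 7) i) /\
  imem M 21 0 = \sum_(0 <= j < N) imem M 7 j%:Z.

(** The potential of the amortized analysis: every proxy with weight left holds the price of one
    discount loop. *)
Definition alive M : nat := (\sum_(0 <= j < N) (1 <= imem M 7 j%:Z)%R)%N.

(** The unspent potential [alive M'] is returned with the budget, so that the [k] passes of a guess
    share it: they cost O(k N + N^2) together instead of O(k N^2). *)
Lemma cover_spec n M (b : nat) rho : proxies M -> (b < N)%N ->
  imem M 18 0 = b%:Z -> rmem M 5 0 = rho -> balanced rho M ->
  (forall j, (j < N)%N -> 0 <= imem M 7 j%:Z) ->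
  (N * 80 + 40 + alive M * (N * 50 + 80) <= n)%N ->
  wp (for_loop 20 10 0 cover_body) n M (fun n' M' =>
    (n - (N * 80 + 40 + alive M * (N * 50 + 80)) + alive M' * (N * 50 + 80) <= n')%N /\
    balanced rho M' /\
    forall j, (j < N)%N -> imem M' 7 j%:Z =
      if mdist (q b) (q j) <= 3 * rho then 0 else imem M 7 j%:Z).
Proof.
move=> px bN bE rhoE bal w0 nN; have [cN pxi] := px.
have [C CE] : exists C, C = (N * 50 + 80)%N by eexists.
rewrite -CE in nN *.
have [rest restE] : exists rest, rest = (n - (N * 80 + 40 + alive M * C))%N.
  by eexists.
rewrite -restE.
pose I (y : nat) n' M' := [/\ balanced rho M', forall j, (j < N)%N ->
    imem M' 7 j%:Z = if (j < y)%N && (mdist (q b) (q j) <= 3 * rho) then 0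
                     else imem M 7 j%:Z &
    ((N - y) * 80 + 30 + alive M' * C + rest <= n')%N].
apply: (wp_for_budget _ _ _ _ N I) => //.
- by move: nN; clear; move: (_ * C)%N => ?; lia.
- split=> //; rewrite subn0 -[alive (put_int _ _ _ _)]/(alive M) restE.
  by move: nN; clear; move: (_ * C)%N => ?; lia.
- by move=> y n' M' [_ _]; clear; move: (_ * C)%N => ?; lia.
- move=> y n' M' yN [fi fr fp] yv [[B8 B21] I7 bn].
  have f18 : imem M' 18 0 = b%:Z by rewrite fi.
  have f6 : imem M' 6 = imem M 6 by rewrite fi.
  have fp0 : pmem M' 0 = pmem M 0 by rewrite fp.
  have f5 : rmem M' 5 0 = rho by rewrite fr.
  have [qb _] := pxi b bN; have [qy _] := pxi y yN.
  have px' : proxies M' by apply: proxies_eq px; rewrite ?fi ?fp.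
  have H7 := I7 y yN; rewrite ltnn /= in H7.
  have E : ((N - y) * 80 = (N - y.+1) * 80 + 80)%N by move: yN; clear; lia.
  rewrite E in bn.
  rewrite /cover_body; apply: wp_if => /=.
  + by move: bn; clear; move: (_ * C)%N => ?; lia.
  + rewrite yv f18 f6 fp0 qb qy f5 => /andP[w1 d].
    have [X XE] : exists X : nat, alive M' = X.+1.
      case A0 : (alive M') => [|X]; last by exists X.
      move/eqP: A0; rewrite /alive big_mkord sum_nat_eq0.
      by move=> /forallP/(_ (Ordinal yN)) /=; rewrite w1.
    rewrite XE mulSn in bn.
    step; apply: (wp_conseq _ _ _ _ _ (discount_spec _ M' y rho px' yN yv f5 _)).
      by move: bn; rewrite CE; clear; move: (X * _)%N => ?; lia.
    move=> n2 M2 [gi gr gp] [bn2 H8].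
    have g7 : imem M2 7 = imem M' 7 by rewrite gi.
    have g20 : imem M2 20 0 = y%:Z by rewrite gi.
    have g21 : imem M2 21 0 = imem M' 21 0 by rewrite gi.
    step; step; first by move: bn bn2; rewrite CE; clear; move: (X * _)%N => ?; lia.
    step; first by move: bn bn2; rewrite CE; clear; move: (X * _)%N => ?; lia.
    split; first by move: bn bn2; rewrite CE; clear; move: (X * _)%N => ?; lia.
    set M3 := put_int _ 20 0 _.
    have h7 j : imem M3 7 j%:Z = if j == y then 0 else imem M' 7 j%:Z.
      by rewrite /M3; ev; rewrite g20 g7 eqz_nat.
    have split_sum (G G' : nat -> int) : (forall j, j != y -> G' j = G j) ->
        \sum_(0 <= j < N) G' j = \sum_(0 <= j < N) G j - G y + G' y.
      move=> GG; rewrite !big_mkord (bigD1 (Ordinal yN)) //=.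
      rewrite [in RHS](bigD1 (Ordinal yN)) //=.
      rewrite (eq_bigr (fun j : 'I_N => G j)) => [|j jy]; last first.
        by apply: GG; apply: contra jy => /eqP e; apply/eqP/val_inj.
      by move: (\sum_(_ < _ | _) _) => s; clear; lia.
    split; [split| |].
    * move=> i iN; rewrite -[imem M3 8]/(imem M2 8) H8 // B8 // /ball_weight.
      rewrite [RHS](split_sum (fun j => if mdist (q i) (q j) <= rho
        then imem M' 7 j%:Z else 0)) => [|j jy]; rewrite h7.
        by rewrite eqxx; case: ifP => _; rewrite ?subr0 ?addr0.
      by rewrite (negbTE jy).
    * have -> : imem M3 21 0 = imem M' 21 0 - imem M' 7 y%:Z.
        by rewrite /M3; ev; rewrite g20 g7 g21.
      rewrite [RHS](split_sum (fun j => imem M' 7 j%:Z)) => [|j jy]; rewrite h7.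
        by rewrite eqxx addr0 B21.
      by rewrite (negbTE jy).
    * move=> j jN; rewrite h7 ltnS leq_eqVlt; case: eqVneq => [->|ne] /=.
        by rewrite d.
      exact: I7.
    * have -> : alive M3 = X.
        clearbody M3.
        apply/eqP; rewrite -eqSS -XE /alive !big_mkord (bigD1 (Ordinal yN)) //=.
        rewrite [X in _ == X](bigD1 (Ordinal yN)) //= h7 eqxx w1 /= add0n add1n eqSS.
        apply/eqP/eq_bigr => j jy; rewrite h7.
        by case: eqVneq => // e; case/negP: jy; apply/eqP/val_inj.
      by move: bn bn2; rewrite CE; clear; move: (X * _)%N => ?; lia.
  + rewrite yv f18 f6 fp0 qb qy f5 => cond.
    step; first by move: bn; clear; move: (_ * C)%N => ?; lia.
    split; first by move: bn; clear; move: (_ * C)%N => ?; lia.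
    split=> //; last first.
      rewrite -[alive (put_int _ _ _ _)]/(alive M').
      by move: bn; clear; move: (_ * C)%N => ?; lia.
    move=> j jN; rewrite ltnS leq_eqVlt -[imem _ 7]/(imem M' 7).
    case: eqVneq => [->|ne] /=; last exact: I7.
    (* A proxy in range that fails the test has no weight left, so its entry is already 0. *)
    case: ifP => // d; rewrite d andbT H7 in cond.
    by rewrite H7; apply/eqP; rewrite eq_le w0 // andbT; move: cond; clear; lia.
- move=> n' M' _ _ [bl I7 bn]; split.
    by move: bn; clear; move: (_ * C)%N => ?; lia.
  by split=> // j jN; rewrite I7 // jN.
Qed.

End Search.

(** * Choosing centers and searching for the radius *)

Section Greedy.
Context {R : realType} {U : metricType R}.
Variables (N : nat) (q : nat -> U) (w : nat -> nat).
Implicit Types (M : memory U) (n : nat) (rho r : R) (cov : pred U).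

Definition uncovered cov (j : nat) : nat := if cov (q j) then 0%N else w j.

Definition gain rho cov (i : nat) : nat :=
  (\sum_(0 <= j < N) (if (mdist (q i) (q j) <= rho)%R then uncovered cov j else 0))%N.

Definition centers rho (t : nat) cov M : Prop :=
  (forall p, cov p -> exists2 i : nat, (i < t)%N &
     mdist (pmem M 1 i%:Z) p <= 3 * rho) /\
  forall i : nat, (i < t)%N -> exists2 j, (j < N)%N & pmem M 1 i%:Z = q j.

Lemma ball_weight_gain rho cov (f : int -> int) i :
  (forall j, (j < N)%N -> f j%:Z = (uncovered cov j)%:Z) ->
  ball_weight N q rho f i = (gain rho cov i)%:Z.
Proof.
move=> fE; rewrite /ball_weight /gain (big_morph Posz PoszD (erefl (Posz 0))).
by rewrite !big_mkord; apply: eq_bigr => j _; case: ifP => // _; rewrite fE.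
Qed.

Lemma alive_le M : (alive N M <= N)%N.
Proof.
rewrite /alive big_mkord; apply: (@leq_trans (\sum_(j < N) 1)%N).
  by apply: leq_sum => j _; case: (_ <= _).
by rewrite sum_nat_const card_ord muln1.
Qed.

(** Separates the program from the analysis: [P] is any property of the covered set that a choice of
    maximal gain maintains. It is instantiated with [progress]. *)
Definition greedy_preserves rho (P : nat -> pred U -> Prop) : Prop :=
  forall t cov b, (b < N)%N -> P t cov ->
    (forall i, (i < N)%N -> gain rho cov i <= gain rho cov b)%N ->
    P t.+1 (fun p => cov p || (mdist (q b) p <= 3 * rho)).

Lemma greedy_spec n M (k : nat) rho (P : nat -> pred U -> Prop) :
  proxies N q w M -> (0 < N)%N -> imem M 5 1 = k%:Z -> rmem M 5 0 = rho ->
  balanced N q rho M -> (forall j, (j < N)%N -> imem M 7 j%:Z = (w j)%:Z) ->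
  greedy_preserves rho P -> P 0%N pred0 ->
  (k * (N * 140 + 200) + N * (N * 50 + 80) + 50 <= n)%N ->
  wp (for_loop 19 5 1 greedy_body) n M (fun n' M' =>
    (n - (k * (N * 140 + 200) + N * (N * 50 + 80) + 50) <= n')%N /\
    exists cov, [/\ centers rho k cov M', P k cov &
      imem M' 21 0 = (\sum_(0 <= j < N) uncovered cov j)%N%:Z]).
Proof.
move=> px N0 Ek rhoE bal w7 Pstep P0 nN.
have [C CE] : exists C, C = (N * 50 + 80)%N by eexists.
have [K KE] : exists K, K = (N * 140 + 200)%N by eexists.
rewrite -CE -KE in nN *.
have [rest restE] : exists rest, rest = (n - (k * K + N * C + 50))%N by eexists.
rewrite -restE.
pose I (t : nat) n' M' := balanced N q rho M' /\ exists cov,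
  [/\ forall j, (j < N)%N -> imem M' 7 j%:Z = (uncovered cov j)%:Z,
      centers rho t cov M', P t cov &
      ((k - t) * K + 30 + alive N M' * C + rest <= n')%N].
apply: (wp_for_budget _ _ _ _ k I) => //.
- by move: nN; clear; move: (_ * C)%N (_ * K)%N => ? ?; lia.
- split=> //; exists pred0; split=> //.
  rewrite subn0 -[alive _ _]/(alive N M) restE.
  have : (alive N M * C <= N * C)%N by rewrite leq_mul2r alive_le orbT.
  by move: nN; clear; move: (_ * C)%N (_ * C)%N (_ * K)%N => ? ? ?; lia.
- move=> t n' M' [_ [cov [_ _ _]]].
  by clear; move: (_ * C)%N (_ * K)%N => ? ?; lia.
- move=> t n' M' tk [fi fr fp] tv [bal' [cov [c7 cen Pt bn]]].
  have px' : proxies N q w M' by apply: (proxies_eq _ _ _ M) => //; rewrite ?fi ?fp.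
  have f5 : rmem M' 5 0 = rho by rewrite fr.
  have c10 : imem M' 10 0 = N%:Z by case: px'.
  have E : ((k - t) * K = K + (k - t.+1) * K)%N.
    by rewrite -mulSn; congr muln; move: tk; clear; lia.
  rewrite E in bn.
  have [X XE] : exists X, X = ((k - t.+1) * K)%N by eexists.
  have [Y YE] : exists Y, Y = (alive N M' * C)%N by eexists.
  rewrite -XE -YE in bn.
  rewrite /greedy_body; step; step; first by move: bn; rewrite KE; clear; lia.
  step.
  apply: (wp_conseq _ _ _ _ _ (heaviest_spec N _ (put_int M' 18 0 0) N0 _ _ _)) => //.
    by move: bn; rewrite KE; clear; lia.
  move=> n1 M1 [gi gr gp] [bn1 [b [bN bE bmax]]].
  have g7 : imem M1 7 = imem M' 7 by rewrite gi.
  have g8 : imem M1 8 = imem M' 8 by rewrite gi.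
  have g21 : imem M1 21 = imem M' 21 by rewrite gi.
  have g19 : imem M1 19 0 = t%:Z by rewrite gi.
  have px1 : proxies N q w M1 by apply: (proxies_eq _ _ _ M') => //; rewrite ?gi ?gp.
  have qb : pmem M1 0 (imem M1 6 b%:Z) = q b by case: px1 => _ /(_ b bN)[].
  have bal1 : balanced N q rho M1 by rewrite /balanced g7 g8 g21.
  have al1 : alive N M1 = alive N M' by rewrite /alive g7.
  step; step; first by move: bn bn1; rewrite KE; clear; lia.
  rewrite bE g19 qb.
  set M2 := put_point M1 1 t%:Z (q b).
  apply: (wp_conseq _ _ _ _ _ (cover_spec N q w _ M2 b rho _ bN _ _ _ _ _)).
  + exact: px1.
  + exact: bE.
  + by rewrite -f5 gr.
  + exact: bal1.
  + by move=> j jN; rewrite -[imem M2 7]/(imem M1 7) g7 c7.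
  + rewrite -[alive N M2]/(alive N M1) al1 -CE -YE.
    by move: bn bn1; rewrite KE; clear; lia.
  rewrite -[alive N M2]/(alive N M1) al1 -CE -YE.
  move=> n3 M3 [hi hr hp] [bn3 [bal3 h7]].
  have [Z ZE] : exists Z, Z = (alive N M3 * C)%N by eexists.
  rewrite -ZE in bn3.
  split; first by move: bn bn1 bn3; rewrite KE; clear; lia.
  split=> //.
  have h1 : pmem M3 1 = pmem M2 1 by rewrite hp.
  have new1 i : (i < t)%N -> pmem M3 1 i%:Z = pmem M' 1 i%:Z.
    move=> it; rewrite h1 /M2; ev; rewrite eqz_nat ltn_eqF //.
    by rewrite gp.
  have new2 : pmem M3 1 t%:Z = q b by rewrite h1 /M2; ev.
  exists (fun p => cov p || (mdist (q b) p <= 3 * rho)); split.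
  + move=> j jN; rewrite -[imem _ 7]/(imem M3 7) h7 //.
    rewrite -[imem M2 7]/(imem M1 7) g7 c7 // /uncovered.
    by case: (cov _); case: (_ <= _).
  + case: cen => cen1 cen2; split=> [p|i] /=.
      move=> /orP[/cen1[i it d]|d]; last by exists t => //; rewrite -[pmem _ 1]/(pmem M3 1) new2.
      by exists i; [exact: ltnW|rewrite -[pmem _ 1]/(pmem M3 1) new1].
    rewrite ltnS leq_eqVlt -[pmem _ 1]/(pmem M3 1) => /predU1P[->|it].
      by exists b.
    by rewrite new1 //; apply: cen2.
  + apply: Pstep => // i iN; have := bmax i iN.
    case: bal' => B8 _; rewrite -[imem (put_int _ _ _ _) 8]/(imem M' 8) !B8 //.
    by rewrite !(ball_weight_gain rho cov).
  + rewrite -[alive _ _]/(alive N M3) -XE -ZE.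
    by move: bn bn1 bn3; rewrite KE; clear; lia.
- move=> n' M' _ _ [[_ b21] [cov [c7 cen Pk bn]]]; split.
    by move: bn; clear; move: (_ * C)%N (_ * K)%N => ? ?; lia.
  exists cov; split=> //; rewrite b21 (big_morph Posz PoszD (erefl (Posz 0))).
  by rewrite !big_mkord; apply: eq_bigr => j _; rewrite c7.
Qed.

Definition guess_cost (k : nat) : nat :=
  (N * (N * 50 + 80) + 20 + (k * (N * 140 + 200) + N * (N * 50 + 80) + 50) + 100)%N.

Lemma guess_spec n M (k : nat) (e r : R) (P : nat -> pred U -> Prop) :
  proxies N q w M -> (0 < N)%N -> imem M 5 1 = k%:Z ->
  rmem M 1 0 = e -> rmem M 4 0 = r ->
  greedy_preserves ((1 + (e + e)) * r) P -> P 0%N pred0 ->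
  (guess_cost k <= n)%N ->
  wp guess_body n M (fun n' M' => (n - guess_cost k <= n')%N /\
    rmem M' 4 0 = r * (1 + e) /\
    exists cov, [/\ centers ((1 + (e + e)) * r) k cov M', P k cov &
      imem M' 21 0 = (\sum_(0 <= j < N) uncovered cov j)%N%:Z]).
Proof.
move=> px N0 Ek eE rE Pstep P0.
set rho := (1 + (e + e)) * r in Pstep *.
have [ca caE] : exists ca, ca = (N * (N * 50 + 80) + 20)%N by eexists.
have [cb cbE] : exists cb, cb = (k * (N * 140 + 200) + N * (N * 50 + 80) + 50)%N.
  by eexists.
rewrite /guess_cost -caE -cbE => nN.
rewrite /guess_body; step; step; first lia.
step; step; first lia.
step; set M1 := put_int _ 21 0 0.
have r1 : rmem M1 5 0 = rho by rewrite /M1; ev; rewrite eE rE.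
apply: (wp_conseq _ _ _ _ _ (weigh_spec N q w _ M1 rho px r1 _ _)) => //.
  by rewrite -caE; lia.
move=> n2 M2 [gi gr gp]; rewrite -caE => -[bn2 [w7 w8 w21]].
have px2 : proxies N q w M2 by apply: (proxies_eq _ _ _ M1) => //; rewrite ?gi ?gp.
step; apply: (wp_conseq _ _ _ _ _ (greedy_spec _ M2 k rho P px2 N0 _ _ _ w7 Pstep P0 _)).
- by rewrite gi.
- by rewrite gr.
- split=> [i iN|]; rewrite ?w8 ?w21 // /ball_weight !big_mkord.
    by apply: eq_bigr => j _; rewrite w7.
  by apply: eq_bigr => j _; rewrite w7.
- by rewrite -cbE; lia.
move=> n3 M3 [hi hr hp]; rewrite -cbE => -[bn3 [cov [cen Pk c21]]].
step; first lia.
have r4 : rmem M3 4 0 = r by rewrite hr // gr.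
have r1' : rmem M3 1 0 = e by rewrite hr // gr.
split; first lia.
split; first by ev; rewrite r4 r1'.
by exists cov.
Qed.

(** A guess that leaves more than [z] uncovered lies below [rs], so the next one is at most
    [(1 + e) * rs], and after [G] failures [rs] is reached. A guess below [rs] may succeed too,
    which only lowers the radius. *)
Lemma search_spec n M (k z G : nat) (e d rs : R) (P : R -> nat -> pred U -> Prop) :
  proxies N q w M -> (0 < N)%N -> imem M 5 1 = k%:Z -> imem M 5 2 = z%:Z ->
  rmem M 1 0 = e -> rmem M 3 0 = d -> 0 < e -> 0 < d ->
  d / 8 <= rs -> rs <= d / 8 * (1 + e) ^+ G ->
  (forall r, 0 < r -> greedy_preserves ((1 + (e + e)) * r) (P r)) ->
  (forall r, P r 0%N pred0) ->
  (forall r cov, P r k cov -> rs <= r ->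
     (\sum_(0 <= j < N) uncovered cov j <= z)%N) ->
  ((G + 1) * (guess_cost k + 20) + 50 <= n)%N ->
  wp search_prog n M (fun n' M' => imem M' 5 0 = k%:Z /\
    exists r cov, [/\ 0 < r, r <= (1 + e) * rs,
      centers ((1 + (e + e)) * r) k cov M' &
      (\sum_(0 <= j < N) uncovered cov j <= z)%N]).
Proof.
move=> px N0 Ek Ez eE dE e0 d0 dl du Pstep P0 Pend nN.
have [W WE] : exists W, W = guess_cost k by eexists.
rewrite -WE in nN.
rewrite /search_prog; step; step; first lia.
step; step; first lia.
step; rewrite dE Ez.
set M1 := put_int _ 21 0 _.
(* The bound on the next guess and the budget for it are promised only if the last guess failed. *)
pose I n' M' := exists i : nat, [/\ proxies N q w M', rmem M' 1 0 = e,
  rmem M' 4 0 = d / 8 * (1 + e) ^+ i,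
  (z%:Z < imem M' 21 0 -> [/\ d / 8 * (1 + e) ^+ i <= (1 + e) * rs, (i <= G)%N &
     ((G - i) * (W + 20) + W + 20 <= n' - 20)%N]) &
  (20 <= n')%N /\
  (imem M' 21 0 <= z%:Z -> exists r cov, [/\ 0 < r, r <= (1 + e) * rs,
      centers ((1 + (e + e)) * r) k cov M' &
      (\sum_(0 <= j < N) uncovered cov j <= z)%N])].
apply: (wp_conseq _ _ _ (fun n' M' => (10 <= n')%N /\ imem M' 5 1 = k%:Z /\
  exists r cov, [/\ 0 < r, r <= (1 + e) * rs,
      centers ((1 + (e + e)) * r) k cov M' &
      (\sum_(0 <= j < N) uncovered cov j <= z)%N])); last first.
  move=> n' M' _ [bn [E5 H]]; step; first lia.
  by split; [ev; rewrite E5|].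
apply: (wp_while _ _ I) => /=.
- exists 0%N; rewrite expr0 mulr1; split=> //.
  + move=> _; split=> //.
      by apply: (le_trans dl); rewrite ler_peMl //; lra.
    rewrite subn0; move: nN; clear.
    rewrite mulnDl mul1n; move: (G * _)%N => x; lia.
  + split; first by move: nN; clear; rewrite mulnDl; move: (G * _)%N => x; lia.
    by rewrite /M1; ev; clear; lia.
- by move=> n' M' _ [i [_ _ _ _ [? _]]]; lia.
- move=> n' M' [fi fr fp] [i [px' e' r4 Hz [bn _]]].
  have -> : imem M' 5 2 = z%:Z by rewrite fi.
  move=> zt; have {}zt : z%:Z < imem M' 21 0 by move: zt; clear; lia.
  have [ri iG bnG] := Hz zt; set r := d / 8 * (1 + e) ^+ i in ri r4.
  have r0 : 0 < r by rewrite /r mulr_gt0 ?divr_gt0 // exprn_gt0 // addr_gt0.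
  have E5 : imem M' 5 1 = k%:Z by rewrite fi.
  apply: (wp_conseq _ _ _ _ _ (guess_spec _ M' k e r (P r) px' N0 E5 e' r4 (Pstep r r0) (P0 r) _)).
    by rewrite -WE; move: bnG; clear; move: (_ * (W + 20))%N => x; lia.
  rewrite -WE => n2 M2 [gi gr gp] [bn2 [r2 [cov [cen Pk c21]]]].
  exists i.+1; split.
  + by apply: (proxies_eq _ _ _ M') => //; rewrite ?gi ?gp.
  + by rewrite gr.
  + by rewrite r2 /r exprSr mulrA.
  + rewrite c21 => zc.
    have rrs : r < rs.
      rewrite ltNge; apply/negP => rs_r; have := Pend _ _ Pk rs_r.
      by move: zc; clear; lia.
    have iG' : (i < G)%N.
      have : r < d / 8 * (1 + e) ^+ G by apply: lt_le_trans rrs du.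
      rewrite /r ltr_pM2l ?divr_gt0 // ltr_eXn2l //.
      by rewrite ltrDl.
    split=> //.
      by rewrite exprSr mulrA -/r mulrC ler_pM2l ?addr_gt0 // ltW.
    have E : ((G - i) * (W + 20) = (W + 20) + (G - i.+1) * (W + 20))%N.
      by rewrite -mulSn; congr muln; move: iG'; clear; lia.
    by move: bnG bn2; rewrite E; clear; move: (_ * (W + 20))%N => x; lia.
  + split; first by move: bnG bn2; clear; move: (_ * (W + 20))%N => x; lia.
    rewrite c21 => cz; exists r, cov; split=> //.
- move=> n' M' [fi fr fp] [i [px' e' r4 Hz [bn Hr]]].
  have -> : imem M' 5 2 = z%:Z by rewrite fi.
  move=> zt; split; first lia.
  split; first by rewrite fi.
  by apply: Hr; move: zt; clear; lia.
Qed.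

End Greedy.

(** * Correctness and running time *)

(** It suffices that [expR (e / 2) <= 1 + e]. This follows from [1 - e / 2 <= expR (- (e / 2))] and
    [(1 + e) * (1 - e / 2) >= 1], the latter because [e <= 1]. *)
Lemma logarithmic_exponent (R : realType) (e x : R) : 0 < e <= 1 -> 1 <= x ->
  exists n : nat, x <= (1 + e) ^+ n /\ n%:R <= 2 * ln x / e + 1.
Proof.
move=> /andP[e0 e1] x1; set y := 2 * ln x / e.
have y0 : 0 <= y by rewrite /y divr_ge0 ?mulr_ge0 ?ln_ge0 // ltW.
have /andP[ty yt] := truncn_itv y0.
exists (Num.truncn y).+1; split; last by rewrite -natr1 lerD2r.
have h : expR (e / 2) <= 1 + e.
  have := expR_ge1Dx (- (e / 2)); rewrite expRN.
  have E0 := expR_gt0 (e / 2); rewrite -(ler_pM2r E0) mulVf ?gt_eqF // => H.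
  have : expR (e / 2) * (1 - e / 2) <= (1 + e) * (1 - e / 2).
    by apply: le_trans (_ : 1 <= _); [rewrite mulrC|nra].
  by rewrite ler_pM2r //; lra.
apply: (@le_trans _ _ (expR (e / 2) ^+ (Num.truncn y).+1)); last first.
  by apply: lerXn2r => //; rewrite nnegrE ?expR_ge0 // addr_ge0 // ltW.
rewrite -expRM_natl -{1}(@lnK _ x) ?posrE ?(lt_le_trans ltr01) // ler_expR.
have -> : ln x = y * (e / 2) by rewrite /y; field; rewrite gt_eqF.
by apply: ler_wpM2r; [lra|exact: ltW].
Qed.

Lemma linked_chain (R : realType) (U : metricType R) (M : memory U) a s :
  linked M a s -> chain (imem M 4) a s.
Proof. by elim: s a => //= b s IH a [-> /IH]. Qed.

Lemma stores_tree_stored (R : realType) (U : metricType R) (S : {fset U})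
    (T : ctree U) root M addr : stores_tree S T root M addr ->
  exists kids, stored S T addr kids M.
Proof.
move=> st.
have ex (v : int * U) : exists s : seq (int * U), explicit_node T v.1 v.2 ->
    [/\ uniq s, forall m q, (m, q) \in s <-> explicit_child T v.1 v.2 m q &
        linked M (imem M 3 (addr v)) (map addr s)].
  have [ev|] := EM (explicit_node T v.1 v.2); last by exists [::].
  by have [s] := st_children st ev; rewrite -surjective_pairing; exists s.
exists (fun v => sval (cid (ex v))) => -[l p] /= ev; split.
  split; [exact: (st_addr st ev)|exact: (st_level st ev)|
    exact: (st_weight st ev)|exact: (st_point st ev)].
by case: cid => s /= /(_ ev)[? ? ?]; split=> //; apply: linked_chain.
Qed.

(** * From proxy weights to points *)

Section Analysis.
Context {R : realType} {U : metricType R}.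
Variables (S : {fset U}) (qs : seq U) (pi : U -> U) (p0 : U).
Hypothesis uq : uniq qs.
Hypothesis piq : forall x, x \in S -> pi x \in qs.

Let q i := nth p0 qs i.
Let w i := count (fun x => pi x == q i) S.
Implicit Types (cov : pred U) (rho : R).

(** Grouping the points of [S] by proxy turns the sums maintained by the program into the counts of
    the clustering argument. *)
Lemma gain_count rho cov i : gain (size qs) q w rho cov i =
  count (fun x => (mdist (q i) (pi x) <= rho) && ~~ cov (pi x)) S.
Proof.
rewrite (count_fibers _ _ pi S qs
  (fun p => (mdist (q i) p <= rho) && ~~ cov p)) //.
rewrite (big_nth p0) big_mkcond /gain; apply: eq_bigr => j _.
by rewrite /uncovered -/(q j); case: (_ <= _); case: (cov _).
Qed.

Lemma uncovered_count cov :
  (\sum_(0 <= j < size qs) uncovered q w cov j)%N =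
  count (fun x => ~~ cov (pi x)) S.
Proof.
rewrite (count_fibers _ _ pi S qs (fun p => ~~ cov p)) //.
rewrite (big_nth p0) [RHS]big_mkcond; apply: eq_bigr => j _.
by rewrite /uncovered -/(q j); case: (cov _).
Qed.

Variables (Cs : {fset U}) (k z : nat) (rs eta e : R).
Hypothesis CsS : (Cs `<=` S)%fset.
Hypothesis Csk : (#|` Cs| <= k)%N.
Hypothesis Csz : (count (predC (near_some rs Cs)) S <= z)%N.
Hypothesis pid : forall x, x \in S -> mdist x (pi x) <= eta.
Hypothesis etae : eta <= e * rs.
Hypothesis e0 : 0 < e.

(* When the guess r is at least the optimum, some k - t optimal clusters
   account for all but z of the points left uncovered by t greedy steps. *)
Definition progress (r : R) (t : nat) (cov : pred U) : Prop := rs <= r ->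
  exists cs, [/\ {subset cs <= Cs}, (size cs <= k - t)%N &
    (count (fun x => ~~ cov (pi x) && ~~ near_some rs cs x) S <= z)%N].

Lemma progress0 r : progress r 0%N pred0.
Proof. by move=> _; exists (enum_fset Cs); rewrite subn0; split. Qed.

(** The ball around the proxy of an optimal center must contain the proxies of the whole cluster.
    Their distance is at most [rs] plus [eta] at either end, which explains the radius
    [(1 + 2e) r]. *)
Lemma progress_step r : 0 < r ->
  greedy_preserves (size qs) q w ((1 + (e + e)) * r) (progress r).
Proof.
move=> r0 t cov b bN Pt mx rsr; have [cs [csC csk csz]] := Pt rsr.
set rho := (1 + (e + e)) * r in mx *.
have rho0 : 0 <= rho by apply: mulr_ge0; move: e0 r0; lra.
have [||cs' [sub sz cz]] := greedy_step S qs cs pi cov (q b) rs rho z rho0 _ _ csz.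
- move=> _ /(nthP p0)[i iN <-]; rewrite -!gain_count.
  exact: mx.
- move=> c /csC cC; have cS : c \in S by move/fsubsetP: CsS; apply.
  exists (pi c); first exact: piq.
  move=> x xS xc; have := pid _ cS; have := pid _ xS.
  have := metric_triangle (pi c) c (pi x); have := metric_triangle c x (pi x).
  rewrite (metric_sym (pi c) c) (metric_sym c x) => t1 t2 t3 t4.
  have : (1 + (e + e)) * rs <= rho by rewrite /rho ler_pM2l //; move: e0; lra.
  by move: etae xc t1 t2 t3 t4; rewrite mulrDl mul1r mulrDl; lra.
exists cs'; split=> //; first by move=> x /sub /csC.
by rewrite (leq_trans sz) // subnS -!subn1 leq_sub2r.
Qed.

Lemma progress_end r cov : progress r k cov -> rs <= r ->
  (\sum_(0 <= j < size qs) uncovered q w cov j <= z)%N.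
Proof.
move=> Pk /Pk[cs [_ + cz]]; rewrite subnn leqn0 size_eq0 => /eqP c0.
rewrite uncovered_count; apply: leq_trans cz.
by apply: leq_count_in => x _; rewrite c0 /= andbT.
Qed.

End Analysis.

(** With [X = (k + z) (64/e)^D] and [lam = (1/e) max(1, ln Delta)] the time bound is [X^2 lam]. The
    numbers of levels and of guesses are at most [10 lam] and [18 lam], each costs O(N^2) steps, and
    [N <= X]. *)
Lemma running_time (R : realType) (k z N Lv G En : nat) (eps D Delta : R) :
  let e := Num.min eps 1 in
  0 < eps -> 0 <= D -> 1 <= Delta -> (k + z < N)%N ->
  N%:R <= (k + z)%:R * (64 / e) `^ D ->
  Lv%:R <= 2 * ln (4 * Delta) / 1 + 1 -> G%:R <= 2 * ln (8 * Delta) / e + 1 ->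
  En%:R <= 1 / e + 1 ->
  ((1000 * En + 100) + ((Lv + 1) * (N * (N * 40 + 200) + 200) + 50) +
    ((G + 1) * (guess_cost N k + 20) + 50))%:R <=
  (30 * 1000)%:R * time_bound k z eps D Delta.
Proof.
move=> e eps0 D0 De1 kzN NX LvB GB EB.
have e0 : 0 < e by rewrite /e lt_min eps0 ltr01.
have e1 : e <= 1 by rewrite /e ge_min lexx orbT.
set lam := 1 / e * Num.max 1 (ln Delta).
set X := _ * _ in NX.
have -> : time_bound k z eps D Delta = X ^+ 2 * lam.
  rewrite /time_bound -/e /X /lam exprMn -[(_ `^ D) ^+ 2]powR_mulrn ?powR_ge0 // -powRrM.
  by rewrite (mulrC D) !mulrA.
set mx := Num.max 1 (ln Delta) in lam *.
have mx1 : 1 <= mx by rewrite /mx le_max lexx.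
have mxl : ln Delta <= mx by rewrite /mx le_max lexx orbT.
have ie1 : 1 <= 1 / e by rewrite ler_pdivlMr // mul1r.
have lnB (c : R) : 0 < c -> ln (c * Delta) <= c - 1 + ln Delta.
  move=> c0; have De0 : 0 < Delta by apply: lt_le_trans De1.
  rewrite lnM ?posrE // lerD2r.
  have {1}-> : c = 1 + (c - 1) by ring.
  by apply: le_ln1Dx; lra.
have lam1 : 1 <= lam by rewrite /lam; nra.
have lame : 1 / e <= lam by rewrite /lam ler_peMr //; lra.
have lamm : mx <= lam by rewrite /lam ler_peMl //; lra.
have {EB}EB : En%:R <= 2 * lam by lra.
have {LvB}LvB : Lv%:R + 1 <= 10 * lam.
  by have := lnB 4 (ltr0n _ 4); rewrite divr1 in LvB; lra.
have {GB}GB : G%:R + 1 <= 18 * lam.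
  have lnG := lnB 8 (ltr0n _ 8).
  have : 2 * ln (8 * Delta) / e <= 16 * lam.
    have -> : 2 * ln (8 * Delta) / e = 1 / e * (2 * ln (8 * Delta)).
      by rewrite mulrC div1r.
    have -> : 16 * lam = 1 / e * (16 * mx) by rewrite /lam mulrCA.
    by apply: ler_wpM2l; lra.
  lra.
have N1 : (1 : R) <= N%:R by rewrite ler1n; move: kzN; clear; lia.
have kN : (k%:R : R) <= N%:R by rewrite ler_nat; move: kzN; clear; lia.
have k0 : (0 : R) <= k%:R by [].
have NN1 : (1 : R) <= N%:R * N%:R by nra.
have NNX : N%:R * N%:R <= X ^+ 2 by rewrite expr2; nra.
have Wd : (N * (N * 40 + 200) + 200)%:R <= 440 * (N%:R * N%:R) :> R.
  by rewrite natrD !natrM natrD natrM; nra.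
have Wg : (guess_cost N k + 20)%:R <= 790 * (N%:R * N%:R) :> R.
  have kN2 : k%:R * N%:R <= N%:R * N%:R :> R by rewrite ler_wpM2r.
  have N2 : N%:R <= N%:R * N%:R :> R by nra.
  rewrite /guess_cost !(natrD, natrM); nra.
set wd := (N * _ + _)%N in Wd *; set wg := (guess_cost N k + 20)%N in Wg *.
clearbody wd wg.
have natE (a b c d v : nat) :
    (a * En + b + ((Lv + v) * wd + c) + ((G + v) * wg + d))%:R =
    a%:R * En%:R + b%:R + ((Lv%:R + v%:R) * wd%:R + c%:R) +
    ((G%:R + v%:R) * wg%:R + d%:R) :> R by rewrite !natrD !natrM !natrD.
rewrite natE natrM {natE}.
have lam0 : 0 <= lam by apply: le_trans lam1.
clearbody lam X.
have wd0 : (0 : R) <= wd%:R by []; have wg0 : (0 : R) <= wg%:R by [].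
have A1 : (Lv%:R + 1) * wd%:R <= 4400 * (lam * (N%:R * N%:R)) :> R.
  have -> : 4400 * (lam * (N%:R * N%:R)) = (10 * lam) * (440 * (N%:R * N%:R)) :> R.
    by ring.
  by apply: ler_pM => //; rewrite addr_ge0.
have A2 : (G%:R + 1) * wg%:R <= 14220 * (lam * (N%:R * N%:R)) :> R.
  have -> : 14220 * (lam * (N%:R * N%:R)) = (18 * lam) * (790 * (N%:R * N%:R)) :> R.
    by ring.
  by apply: ler_pM => //; rewrite addr_ge0.
have A3 : lam <= lam * (N%:R * N%:R) by rewrite ler_peMr.
have A4 : lam * (N%:R * N%:R) <= X ^+ 2 * lam by rewrite mulrC ler_wpM2r.
move: A1 A2 A3 A4 EB lam1; clear.
move: (lam * (N%:R * N%:R)) (X ^+ 2 * lam) ((_ + 1) * wd%:R) ((_ + 1) * wg%:R).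
by move=> a b c d; lra.
Qed.

(** The origin of 64: since [2^j e < 8], the [j + 3] halvings give [2^(j+3) <= 64/e], raised to the
    power [D]. *)
Lemma size_proxies (R : realType) (U : metricType R) (S : {fset U}) (T : ctree U)
    (D e : R) (K j : nat) (l : int) :
  cover_tree S T -> doubling (U := U) D -> 0 <= D -> 0 < e ->
  l + 1 <= root_level T -> (#|` pts T (l + 1)| <= K)%N -> 2 ^+ j * e < 8 ->
  (#|` pts T (l - j%:Z)|)%:R <= K%:R * (64 / e) `^ D.
Proof.
move=> HT dD D0 e0 lr cK je.
apply: le_trans (card_level_le _ _ HT _ _ j dD lr) _.
apply: ler_pM; rewrite ?ler0n ?exprn_ge0 ?powR_ge0 ?ler_nat //.
rewrite -powR_mulrn ?powR_ge0 // -powRrM mulrC powRrM powR_mulrn //.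
apply: ge0_ler_powR; rewrite ?nnegrE ?exprn_ge0 ?divr_ge0 // ?ltW //.
by rewrite exprD ltr_pdivlMr //; move: je; rewrite -[2 ^+ 3]natrX; lra.
Qed.

(** The origin of the lower limit 4: [2^(l+1)] is below [4 rs], and dividing by [2^j >= 4/e] leaves
    at most [e rs]. *)
Lemma proxy_scale (R : realType) (e rs : R) (l : int) (j : nat) :
  4 <= 2 ^+ j * e -> 2 ^ l < 2 * rs -> (2 : R) ^ (l - j%:Z + 1) <= e * rs.
Proof.
move=> je ls.
have p0 : 0 < (2 : R) ^+ j by rewrite exprn_gt0.
have -> : (2 : R) ^ (l - j%:Z + 1) = 2 * 2 ^ l / 2 ^+ j.
  by rewrite pow2S expfzDr // -invr_expz mulrA.
rewrite ler_pdivrMr //.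
have rs0 : 0 < rs by have := pow2_gt0 (R := R) l; lra.
have : 4 * rs <= 2 ^+ j * e * rs by rewrite ler_pM2r.
by rewrite [e * rs * _]mulrC mulrA; lra.
Qed.

Theorem theorem4 :
  exists (P : cmd) (c1 c2 : nat),
  forall (R : realType) (U : metricType R) (D : R) (S : {fset U})
    (k z : nat) (eps : R) (T : ctree U) (M : memory U),
  doubling_dimension U D ->
  (0 < k)%N -> (0 < z)%N -> (k + z < #|` S|)%N ->
  0 < eps ->
  cover_tree S T ->
  input S T k z eps M ->
  exists (t : nat) (M' : memory U) (C : {fset U}),
    [/\ exec P M t M' /\ output M' C,
        (C `<=` S)%fset /\ (#|` C| <= k)%N,
        (outlier_radius S z C <= (3 + c1%:R * eps)%:E * opt_radius S k z)%E
      & t%:R <= c2%:R * time_bound k z eps D (aspect_ratio S)].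
Proof.
(* For [e <= 1], [3 (1 + 2e)(1 + e) + e <= 3 (1 + 5e) + e = 3 + 16e]; the last [e] is the distance
   from a point to its proxy. *)
exists cluster_prog, 16%N, (30 * 1000)%N.
move=> R U D S k z eps T M [D0 dD _] k0 z0 kzS eps0 HT [[addr st] Ek Ez Eeps].
have [kids sto] := stores_tree_stored _ _ _ _ _ _ _ st.
have [l lr [cl1 cl]] := level_of_count _ _ HT (k + z) (ltn_addr _ k0) kzS.
set e := Num.min eps 1.
have e0 : 0 < e by rewrite /e lt_min eps0 ltr01.
have e1 : e <= 1 by rewrite /e ge_min lexx orbT.
have eeps : e <= eps by rewrite /e ge_min lexx.
have [rs [Cs [optE /andP[rs0 rsd] CsS Csk Csz]]] :=
  opt_radiusP S k z k0 (leq_ltn_trans (leq0n _) kzS).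
have ls : 2 ^ l < 2 * rs.
  apply: (packing_lower_bound S (pts T l) Cs k z rs) => //.
  - exact: fset_uniq.
  - by move=> x xl; apply: (node_in_set _ _ HT l).
  - by move=> a b al bl; apply: (ct_separation HT).
have [x0 [y0 [x0S y0S xy0]]] : exists x0 y0, [/\ x0 \in S, y0 \in S & x0 != y0].
  have : (1 < size (S : seq U))%N by apply: leq_ltn_trans kzS; move: k0; clear; lia.
  have := fset_uniq S; case E : (S : seq U) => [|x [|y s]] //= /andP[xs _] _.
  exists x, y; split.
  - by rewrite -[_ \in _]/(x \in enum_fset S) E mem_head.
  - by rewrite -[_ \in _]/(y \in enum_fset S) E !inE eqxx orbT.
  - by move: xs; rewrite inE negb_or => /andP[].
have dn0 := dmin_gt0 S _ _ x0S y0S xy0.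
have dnx : dmin S <= dmax S.
  exact: le_trans (dmin_le S _ _ x0S y0S xy0) (le_dmax S _ _ x0S y0S).
set De := aspect_ratio S.
have De1 : 1 <= De by rewrite /De /aspect_ratio ler_pdivlMr // mul1r.
(* The value 1 for [e] gives base 2: [Lv] bounds the visited levels, and [G] below the guesses. *)
have [Lv [LvE LvB]] := logarithmic_exponent R 1 (4 * De) ltac:(lra) ltac:(lra).
have [G [GE GB]] := logarithmic_exponent R e (8 * De)
  ltac:(by rewrite e0 e1) ltac:(lra).
have ie0 : 0 <= 1 / e by rewrite divr_ge0 // ltW.
have [En [EnE EnB]] : exists En : nat, 1 / e <= En%:R /\ En%:R <= 1 / e + 1.
  exists (Num.truncn (1 / e)).+1; have /andP[h1 h2] := truncn_itv ie0.
  by rewrite -natr1; split; [rewrite natr1 ltW|lra].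
(* The budget depends on [N], hence on [j], before the program runs. Its existence is read off a
   separate run of the doubling loop, and uniqueness identifies it with the value computed later. *)
have [j j4 j8] : exists2 j : nat, 4 <= 2 ^+ j * e & 2 ^+ j * e < 8.
  have [t [M1 [_ _ [_ [_ [j [_ ? ?]]]]]]] :=
    depth_spec _ M eps En Eeps eps0 EnE (leqnn _).
  by exists j.
have j_uniq i : 4 <= 2 ^+ i * e -> 2 ^+ i * e < 8 -> i = j.
  suff H a b : 4 <= 2 ^+ a * e -> 2 ^+ b * e < 8 -> (b <= a)%N.
    by move=> i4 i8; apply/eqP; rewrite eqn_leq !H.
  move=> a4 b8; rewrite leqNgt; apply/negP => ab.
  have : 2 ^+ a.+1 * e <= 2 ^+ b * e.
    by rewrite ler_pM2r // ler_eXn2l // ltr1n.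
  by rewrite exprS; move: a4 b8; lra.
set L := l - j%:Z; have lL : L <= l by rewrite /L; clear; lia.
have Lr : L <= root_level T by apply: le_trans lL (ltW lr).
have [N NE] : exists N, N = #|` pts T L| by eexists.
have kzN : (k + z < N)%N by rewrite NE (leq_trans cl) // (card_nested _ _ HT).
have N0 : (0 < N)%N by apply: leq_ltn_trans kzN.
have NB : N%:R <= (k + z)%:R * (64 / e) `^ D.
  by rewrite NE; apply: (size_proxies _ _ S) => //; rewrite lezD1.
have [pi [piP piw]] := proxy_map S T L HT Lr.
have [c1 c1E] : exists c1, c1 = (1000 * En + 100)%N by eexists.
have [c2 c2E] : exists c2, c2 = ((Lv + 1) * (N * (N * 40 + 200) + 200) + 50)%N.
  by eexists.
have [c3 c3E] : exists c3, c3 = ((G + 1) * (guess_cost N k + 20) + 50)%N.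
  by eexists.
have eta_le := proxy_scale _ _ _ _ _ j4 ls.
suff [t [M' [ex tc [E5 [C [CE CS [r [r0 rB rC]]]]]]]] :
    wp cluster_prog (c1 + c2 + c3) M (fun _ M' => imem M' 5 0 = k%:Z /\
      exists C : {fset U}, [/\ C = seq_fset tt [seq pmem M' 1 i%:Z | i <- iota 0 k],
        (C `<=` S)%fset & exists r, [/\ 0 <= r, r <= (3 + 16 * eps) * rs &
        (count (predC (near_some r C)) S <= z)%N]]).
  exists t, M', C; split.
  - by split=> //; exists k.
  - split=> //; rewrite CE size_seq_fset.
    by apply: leq_trans (size_undup _) _; rewrite size_map size_iota.
  - rewrite optE -EFinM; apply: le_trans (outlier_radius_le _ _ _ _ r0 rC) _.
    by rewrite lee_fin.
  - apply: le_trans (_ : (c1 + c2 + c3)%:R <= _); first by rewrite ler_nat.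
    by rewrite c1E c2E c3E; apply: running_time.
rewrite /cluster_prog; apply: wp_seq.
apply: (wp_conseq _ _ _ _ _ (depth_spec _ M eps En Eeps eps0 EnE _)).
  by rewrite -c1E; clear; lia.
rewrite -c1E -/e => n1 M1 [fi1 fr1 fp1] [bn1 [e1M [j' [j15 j'4 j'8]]]].
have {j'4 j'8} Ej := j_uniq _ j'4 j'8; rewrite {j'}Ej in j15.
apply: wp_seq.
have sto1 : stored S T addr kids M1.
  by move=> v /sto; rewrite fi1 // fi1 // fp1 // fi1 // fi1.
have rt1 p : node T (root_level T) p -> imem M1 5 0 = addr (root_level T, p).
  by rewrite fi1 // => /(st_root st)[].
have Ek1 : imem M1 5 1 = k%:Z by rewrite fi1.
have Ez1 : imem M1 5 2 = z%:Z by rewrite fi1.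
have LvE' : 4 * aspect_ratio S <= 2 ^+ Lv by move: LvE; rewrite -/De.
apply: (wp_conseq _ _ _ _ _ (descend_spec S T HT n1 M1 addr kids k z j N Lv l
  sto1 rt1 Ek1 Ez1 j15 k0 cl1 cl NE LvE' _)).
  by rewrite -c2E; move: bn1; clear; lia.
rewrite -c2E => n2 M2 [fi2 fr2 fp2] [bn2 [fr [F F6 c10 szN [a [b [aS bS ab dab d4]]]]]].
have [uq mq fP] := F.
set qs := map snd fr in uq mq.
have sq : size qs = N by rewrite size_map.
pose q i := nth x0 qs i; pose w i := count (fun x => pi x == q i) S.
have piq x : x \in S -> pi x \in qs by move=> /piP[]; rewrite mq.
have qS i : (i < N)%N -> q i \in S.
  move=> iN; apply: (node_in_set _ _ HT L); rewrite -mq.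
  by apply: mem_nth; rewrite sq.
have px : proxies N q w M2.
  split=> // i iN; have iF : (i < size fr)%N by rewrite szN.
  pose v := nth (0, x0) fr i.
  have vfr : v \in fr by apply: mem_nth.
  have qv : q i = v.2 by rewrite /q (nth_map (0, x0)).
  rewrite F6 ?size_map // (nth_map (0, x0)) // -/v.
  have [ev _ _] := fP _ vfr; have [[_ _ wv pv] _] := sto1 v ev.
  rewrite fp2 // pv fi2 // wv qv; split=> //.
  by rewrite (frontier_weight _ _ HT _ _ _ F vfr) piw /w qv.
have d0 : 0 < mdist a b by rewrite mdist_gt0.
(* The recorded distance is at most [4 * 2^l], and [2^l < 2 * rs]. *)
have rs1 : mdist a b / 8 <= rs by move: d4 ls; clear; lra.
(* From [dmin S / 8] to [dmax S] the ratio is [8 * De], which [(1 + e) ^+ G] dominates. *)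
have rs2 : rs <= mdist a b / 8 * (1 + e) ^+ G.
  apply: (le_trans rsd).
  have -> : dmax S = dmin S / 8 * (8 * De).
    by rewrite /De /aspect_ratio; field; rewrite gt_eqF.
  apply: ler_pM => //.
  - by rewrite divr_ge0 // ltW.
  - by move: De1; clear; lra.
  - by rewrite ler_pM2r ?invr_gt0 // dmin_le.
have e2 : rmem M2 1 0 = e by rewrite fr2.
have Ek2 : imem M2 5 1 = k%:Z by rewrite fi2.
have Ez2 : imem M2 5 2 = z%:Z by rewrite fi2.
have pid x : x \in S -> mdist x (pi x) <= 2 ^ (L + 1) by case/piP.
apply: (wp_conseq _ _ _ _ _ (search_spec N q w n2 M2 k z G e (mdist a b) rs
  (progress S pi Cs k z rs) px N0 Ek2 Ez2 e2 dab e0 d0 rs1 rs2 _ _ _ _)).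
- move=> r r0; rewrite -sq.
  exact: (progress_step S qs pi x0 uq piq Cs k z rs _ e CsS pid eta_le e0 r r0).
- by move=> r; apply: progress0.
- move=> r cov; rewrite -sq; apply: (progress_end S qs pi x0 uq piq Cs).
- by rewrite -c3E; move: bn1 bn2; clear; lia.
move=> n3 M3 _ [E5 [r [cov [r0 rB [cen1 cen2] cz]]]]; split=> //.
set C := seq_fset tt _; exists C.
have memC i : (i < k)%N -> pmem M3 1 i%:Z \in C.
  by move=> ik; rewrite seq_fsetE; apply/mapP; exists i; rewrite // mem_iota.
split=> //.
  apply/fsubsetP => x; rewrite seq_fsetE => /mapP[i]; rewrite mem_iota add0n.
  by move=> /cen2[i' i'N ->] ->; apply: qS.
set eta := (2 : R) ^ (L + 1) in pid eta_le.
have eta0 : 0 <= eta by rewrite ltW // pow2_gt0.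
(* A point is within [eta] of its proxy, and a covered proxy within three ball radii of a center. *)
exists (3 * ((1 + (e + e)) * r) + eta); split.
- by apply: addr_ge0 => //; apply: mulr_ge0 => //; apply: mulr_ge0; move: e0 r0; clear; lra.
- have h1 : (1 + (e + e)) * r <= (1 + (e + e)) * ((1 + e) * rs).
    by rewrite ler_pM2l //; move: e0; clear; lra.
  have h2 : (1 + (e + e)) * ((1 + e) * rs) <= (1 + 5 * e) * rs.
    by rewrite mulrA ler_wpM2r //; move: e0 e1; clear; nra.
  have h3 : (3 + 16 * e) * rs <= (3 + 16 * eps) * rs.
    by rewrite ler_wpM2r //; move: eeps; clear; lra.
  apply: le_trans h3; move: h1 h2 eta_le; clear.
  have -> : (1 + 5 * e) * rs = rs + 5 * (e * rs) by ring.
  have -> : (3 + 16 * e) * rs = 3 * rs + 16 * (e * rs) by ring.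
  by move: ((1 + (e + e)) * ((1 + e) * rs)) ((1 + (e + e)) * r) (e * rs) => x y m; lra.
- apply: leq_trans cz; rewrite -sq (uncovered_count S qs pi x0 uq piq).
  apply: leq_count_in => x xS /=; apply: contra => /cen1[i ik d].
  apply/hasP; exists (pmem M3 1 i%:Z); first exact: memC.
  apply: le_trans (metric_triangle _ (pi x) _) _.
  by rewrite addrC lerD ?pid // metric_sym.
Qed.
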